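(* Let $d\ge2$ be an integer, let $0\le f\in C^\alpha(\mathbb{T})$ for some $0<\alpha\le1$, and suppose that the transfer operator $L:C(\mathbb{T})\to C(\mathbb{T})$, $(Lu)(t)=\frac1d\sum_{i=0}^{d-1} f\left(\frac{t+i}{d}\right)u\left(\frac{t+i}{d}\right)$, is a Krein operator. Let $r=\lim_{n\to\infty}\left(\min_{t\in\mathbb{T}}(L^n1)(t)\right)^{1/n}$, $R=\lim_{n\to\infty}\left(\max_{t\in\mathbb{T}}(L^n1)(t)\right)^{1/n}$, and $$c(f)=\limsup_{n\to\infty}|I_n(f)|^{1/n},\qquad I_n(f)=\int_0^1\prod_{j=0}^{n-1}f(d^jt)\,dt.$$ Then $r=c(f)=R=\rho(L)$, where $\rho(L)$ is the spectral radius of $L$. Moreover, the $\limsup$ in the definition of $c(f)$ can be replaced by $\lim$.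
   Context: $\mathbb{T}=\mathbb{R}/\mathbb{Z}$ is identified with $[0,1]$ with $0$ and $1$ identified; functions on $\mathbb{T}$ are viewed as $1$-periodic functions on $\mathbb{R}$. $C(\mathbb{T})$ is the Banach space of continuous complex-valued functions on $\mathbb{T}$ with the maximum norm. $C^\alpha(\mathbb{T})$ is the space of functions $u:\mathbb{T}\to\mathbb{C}$ that are H\''older continuous with exponent $\alpha$ (Lipschitz if $\alpha=1$). A function $w\in C(\mathbb{T})$ is a unit if $w(t)>0$ for all $t$. $L$ is a Krein operator if, for every $u\in C(\mathbb{T})$ with $u\ge0$ everywhere and $u(t_0)>0$ for at least one $t_0$, there is $n\in\mathbb{N}$ such that $L^nu$ is a unit. The limits defining $r$ and $R$ always exist. *)

(* Defs.v *)
From Stdlib Require Import Reals ZArith Lra Lia FunctionalExtensionality ProofIrrelevance.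
From Coquelicot Require Import Coquelicot.
Open Scope R_scope.

(* Extrema over T of a 1-periodic real function, as least upper and greatest
   lower bounds of its range; [Tmax_attained] and [Tmin_attained] show that for
   continuous functions they are a genuine maximum and minimum. *)

Definition Tmax (g : R -> R) : R := real (Lub_Rbar (fun y => exists t, y = g t)).
Definition Tmin (g : R -> R) : R := real (Glb_Rbar (fun y => exists t, y = g t)).

Lemma periodic_nat {A : Type} (g : R -> A) :
  (forall t, g (t + 1) = g t) -> forall (n : nat) t, g (t + INR n) = g t.
Proof.
intros Hp n; induction n as [|n IH]; intros t.
- now rewrite Rplus_0_r.
- rewrite S_INR, <- Rplus_assoc, Hp; apply IH.
Qed.

Lemma periodic_Z {A : Type} (g : R -> A) :
  (forall t, g (t + 1) = g t) -> forall (k : Z) t, g (t + IZR k) = g t.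
Proof.
intros Hp k t; destruct (Z.le_gt_cases 0 k) as [Hk|Hk].
- rewrite <- (Z2Nat.id k Hk), <- INR_IZR_INZ; now apply periodic_nat.
- assert (Hk' : (0 <= - k)%Z) by lia.
  rewrite <- (periodic_nat g Hp (Z.to_nat (- k)) (t + IZR k)).
  rewrite INR_IZR_INZ, (Z2Nat.id _ Hk'), opp_IZR; f_equal; ring.
Qed.

Lemma periodic_unit_interval {A : Type} (g : R -> A) :
  (forall t, g (t + 1) = g t) -> forall t, exists s, 0 <= s <= 1 /\ g t = g s.
Proof.
intros Hp t; exists (t + IZR (- Int_part t)); split.
- rewrite opp_IZR; destruct (base_Int_part t); lra.
- symmetry; now apply periodic_Z.
Qed.

Lemma Tmax_eq (g : R -> R) (t : R) : (forall s, g s <= g t) -> Tmax g = g t.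
Proof.
intros H; unfold Tmax.
rewrite (is_lub_Rbar_unique _ (g t)); [reflexivity|split].
- intros y [s ->]; apply H.
- intros b Hb; apply Hb; now exists t.
Qed.

Lemma Tmin_eq (g : R -> R) (t : R) : (forall s, g t <= g s) -> Tmin g = g t.
Proof.
intros H; unfold Tmin.
rewrite (is_glb_Rbar_unique _ (g t)); [reflexivity|split].
- intros y [s ->]; apply H.
- intros b Hb; apply Hb; now exists t.
Qed.

Lemma Tmax_attained (g : R -> R) :
  (forall t, g (t + 1) = g t) -> (forall t, continuous g t) ->
  exists t, Tmax g = g t /\ forall s, g s <= g t.
Proof.
intros Hp Hc.
destruct (continuity_ab_maj g 0 1) as [M [HM _]]; [lra| |].
- intros c _; apply continuity_pt_filterlim, Hc.
- assert (H : forall s, g s <= g M).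
  { intros s; destruct (periodic_unit_interval g Hp s) as [s' [Hs' ->]].
    now apply HM. }
  exists M; split; [now apply Tmax_eq|exact H].
Qed.

Lemma Tmin_attained (g : R -> R) :
  (forall t, g (t + 1) = g t) -> (forall t, continuous g t) ->
  exists t, Tmin g = g t /\ forall s, g t <= g s.
Proof.
intros Hp Hc.
destruct (continuity_ab_min g 0 1) as [M [HM _]]; [lra| |].
- intros c _; apply continuity_pt_filterlim, Hc.
- assert (H : forall s, g M <= g s).
  { intros s; destruct (periodic_unit_interval g Hp s) as [s' [Hs' ->]].
    now apply HM. }
  exists M; split; [now apply Tmin_eq|exact H].
Qed.

Record CT : Type := mkCT {
  CT_fun :> R -> C;
  CT_periodic : forall t, CT_fun (t + 1) = CT_fun t;
  CT_continuous : forall t, continuous CT_fun t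
}.

Lemma CT_ext (u v : CT) : (forall t, u t = v t) -> u = v.
Proof.
destruct u as [u pu cu], v as [v pv cv]; simpl; intros H.
assert (E : u = v) by now apply functional_extensionality.
subst v; f_equal; apply proof_irrelevance.
Qed.

Lemma continuous_Cmult (f g : R -> C) (t : R) :
  continuous f t -> continuous g t -> continuous (fun s => Cmult (f s) (g s)) t.
Proof.
intros Hf Hg.
assert (F1 : continuous (fun s => fst (f s)) t)
  by (apply (continuous_comp f fst); [exact Hf|apply continuous_fst]).
assert (F2 : continuous (fun s => snd (f s)) t)
  by (apply (continuous_comp f snd); [exact Hf|apply continuous_snd]).
assert (G1 : continuous (fun s => fst (g s)) t)
  by (apply (continuous_comp g fst); [exact Hg|apply continuous_fst]).
assert (G2 : continuous (fun s => snd (g s)) t)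
  by (apply (continuous_comp g snd); [exact Hg|apply continuous_snd]).
unfold Cmult.
apply (continuous_comp_2
  (fun s => fst (f s) * fst (g s) - snd (f s) * snd (g s))
  (fun s => fst (f s) * snd (g s) + snd (f s) * fst (g s)) (fun x y => (x, y))).
- apply (continuous_minus (fun s => fst (f s) * fst (g s))
                          (fun s => snd (f s) * snd (g s)));
  now apply (continuous_mult (K := R_AbsRing)).
- apply (continuous_plus (fun s => fst (f s) * snd (g s))
                         (fun s => snd (f s) * fst (g s)));
  now apply (continuous_mult (K := R_AbsRing)).
- apply (continuous_ext (fun p : R * R => p)); [now intros []|apply continuous_id].
Qed.

Lemma continuous_Cmod_comp (f : R -> C) (t : R) :
  continuous f t -> continuous (fun s => Cmod (f s)) t.
Proof.
intros Hf; apply (continuous_comp f Cmod); [exact Hf|].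
apply (filterlim_norm (V := C_NormedModule)).
Qed.

Definition CT_const (c : C) : CT :=
  mkCT (fun _ => c) (fun _ => eq_refl) (fun t => continuous_const c t).

Program Definition CT_plus (u v : CT) : CT := mkCT (fun t => u t + v t)%C _ _.
Next Obligation. now rewrite !CT_periodic. Qed.
Next Obligation. apply (continuous_plus (V := C_NormedModule) u v); apply CT_continuous. Qed.

Program Definition CT_scal (c : C) (u : CT) : CT := mkCT (fun t => c * u t)%C _ _.
Next Obligation. now rewrite !CT_periodic. Qed.
Next Obligation.
apply (continuous_Cmult (fun _ => c) u); [apply continuous_const|apply CT_continuous].
Qed.

Definition CT_opp (u : CT) : CT := CT_scal (- 1)%C u.

Definition CT_norm (u : CT) : R := Tmax (fun t => Cmod (u t)).

Lemma CT_norm_attained (u : CT) :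
  exists t, CT_norm u = Cmod (u t) /\ forall s, Cmod (u s) <= Cmod (u t).
Proof.
apply (Tmax_attained (fun t => Cmod (u t))).
- intros t; now rewrite CT_periodic.
- intros t; apply continuous_Cmod_comp, CT_continuous.
Qed.

Lemma CT_norm_ge (u : CT) (t : R) : Cmod (u t) <= CT_norm u.
Proof. destruct (CT_norm_attained u) as [s [-> H]]; apply H. Qed.

Lemma CT_norm_le (u : CT) (M : R) : (forall t, Cmod (u t) <= M) -> CT_norm u <= M.
Proof. intros H; destruct (CT_norm_attained u) as [s [-> _]]; apply H. Qed.

Definition CT_AbelianMonoid_mixin : AbelianMonoid.mixin_of CT.
Proof.
apply (AbelianMonoid.Mixin CT CT_plus (CT_const 0%C));
  intros; apply CT_ext; intros t; simpl; ring.
Defined.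

Canonical CT_AbelianMonoid := AbelianMonoid.Pack CT CT_AbelianMonoid_mixin CT.

Definition CT_AbelianGroup_mixin : AbelianGroup.mixin_of CT_AbelianMonoid.
Proof.
apply (AbelianGroup.Mixin CT_AbelianMonoid CT_opp).
intros; apply CT_ext; intros t; simpl; ring.
Defined.

Canonical CT_AbelianGroup :=
  AbelianGroup.Pack CT
    (AbelianGroup.Class CT CT_AbelianMonoid_mixin CT_AbelianGroup_mixin) CT.

Definition CT_ModuleSpace_mixin : ModuleSpace.mixin_of C_Ring CT_AbelianGroup.
Proof.
apply (ModuleSpace.Mixin C_Ring CT_AbelianGroup CT_scal);
  intros; apply CT_ext; intros t; cbn; unfold one; cbn; ring.
Defined.

Canonical CT_ModuleSpace :=
  ModuleSpace.Pack C_Ring CT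
    (ModuleSpace.Class C_Ring CT (AbelianGroup.class CT_AbelianGroup)
       CT_ModuleSpace_mixin) CT.

Lemma CT_minus_fun (u v : CT) (t : R) : (minus u v : CT) t = (u t - v t)%C.
Proof. cbn; ring. Qed.

Lemma CT_norm_triangle (u v : CT) : CT_norm (plus u v) <= CT_norm u + CT_norm v.
Proof.
apply CT_norm_le; intros t.
apply Rle_trans with (1 := Cmod_triangle (u t) (v t)).
apply Rplus_le_compat; apply CT_norm_ge.
Qed.

Definition CT_ball (u : CT) (eps : R) (v : CT) : Prop := CT_norm (minus v u) < eps.

Definition CT_UniformSpace_mixin : UniformSpace.mixin_of CT.
Proof.
apply (UniformSpace.Mixin CT (CT_const 0%C) CT_ball).
- intros u e; apply Rle_lt_trans with 0; [|apply cond_pos].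
  apply CT_norm_le; intros t; rewrite CT_minus_fun.
  replace (u t - u t)%C with (RtoC 0) by ring; rewrite Cmod_0; lra.
- intros u v e; apply Rle_lt_trans, CT_norm_le; intros t.
  rewrite CT_minus_fun, <- Cmod_opp.
  replace (- (u t - v t))%C with ((minus v u : CT) t)
    by (rewrite CT_minus_fun; ring).
  apply CT_norm_ge.
- intros u v w e1 e2 H1 H2; unfold CT_ball in *.
  replace (minus w u) with (plus (minus w v) (minus v u)).
  + apply Rle_lt_trans with (1 := CT_norm_triangle _ _); lra.
  + apply CT_ext; intros t; cbn; ring.
Defined.

Canonical CT_UniformSpace := UniformSpace.Pack CT CT_UniformSpace_mixin CT.

Canonical CT_NormedModuleAux :=
  NormedModuleAux.Pack C_AbsRing CT
    (NormedModuleAux.Class C_AbsRing CT (ModuleSpace.class C_Ring CT_ModuleSpace)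
       CT_UniformSpace_mixin) CT.

Definition CT_NormedModule_mixin : NormedModule.mixin_of C_AbsRing CT_NormedModuleAux.
Proof.
apply (NormedModule.Mixin C_AbsRing CT_NormedModuleAux CT_norm 1).
- exact CT_norm_triangle.
- intros c u; apply CT_norm_le; intros t.
  change (Cmod (c * u t)%C <= Cmod c * CT_norm u); rewrite Cmod_mult.
  apply Rmult_le_compat_l; [apply Cmod_ge_0|apply CT_norm_ge].
- intros u v eps H; exact H.
- intros u v eps H; rewrite Rmult_1_l; exact H.
- intros u H; apply CT_ext; intros t; apply Cmod_eq_0, Rle_antisym.
  + rewrite <- H; apply CT_norm_ge.
  + apply Cmod_ge_0.
Defined.

Canonical CT_NormedModule :=
  NormedModule.Pack C_AbsRing CT
    (NormedModule.Class C_AbsRing CT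
       (NormedModuleAux.class C_AbsRing CT_NormedModuleAux)
       CT_NormedModule_mixin) CT.

(* [is_linear] includes boundedness. *)

Definition in_resolvent_set {V : NormedModule C_AbsRing} (T : V -> V) (z : C) : Prop :=
  exists S : V -> V, is_linear S /\
    (forall x, S (minus (scal z x) (T x)) = x) /\
    (forall x, minus (scal z (S x)) (T (S x)) = x).

Definition in_spectrum {V : NormedModule C_AbsRing} (T : V -> V) (z : C) : Prop :=
  ~ in_resolvent_set T z.

Definition spectral_radius {V : NormedModule C_AbsRing} (T : V -> V) : Rbar :=
  Lub_Rbar (fun x => exists z : C, in_spectrum T z /\ x = Cmod z).

(* For complex z, z >= 0 means that z is real and nonnegative. *)

Definition Cge0 (z : C) : Prop := Im z = 0 /\ 0 <= Re z.
Definition Cgt0 (z : C) : Prop := Im z = 0 /\ 0 < Re z.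

Definition CT_nonneg (u : CT) : Prop := forall t, Cge0 (u t).
Definition CT_unit (w : CT) : Prop := forall t, Cgt0 (w t).

Definition krein (L : CT -> CT) : Prop :=
  forall u : CT, CT_nonneg u -> (exists t0, Cgt0 (u t0)) ->
    exists n : nat, CT_unit (Nat.iter n L u).

(* For a 1-periodic function, Hölder continuity on R and on T are the same. The
   case [s = t] is left out because [Rpower 0 alpha] is 1 instead of 0. *)
Definition holder (alpha : R) (u : CT) : Prop :=
  exists K : R, forall s t, s <> t ->
    Cmod (u s - u t) <= K * Rpower (Rabs (s - t)) alpha.

(* [sum_n a n] has n + 1 terms, so the sum runs over i = 0, ..., d - 1. *)

Definition transfer_fun (d : nat) (f u : R -> C) (t : R) : C :=
  (RtoC (/ INR d) *
   sum_n (fun i => f ((t + INR i) / INR d)%R * u ((t + INR i) / INR d)%R) (pred d))%C.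

Lemma transfer_periodic (d : nat) (f u : CT) (t : R) :
  transfer_fun d f u (t + 1) = transfer_fun d f u t.
Proof.
unfold transfer_fun; f_equal; destruct d as [|k].
- apply sum_n_ext; intros i; simpl INR; unfold Rdiv.
  now rewrite Rinv_0, !Rmult_0_r.
- set (d := INR (S k)); set (a := fun i => (f ((t + INR i) / d)%R * u ((t + INR i) / d)%R)%C).
  assert (Hd : d <> 0) by (apply not_0_INR; discriminate).
  change (pred (S k)) with k.
  rewrite (sum_n_ext _ (fun i => a (S i))).
  2:{ intros i; unfold a; rewrite S_INR.
      now replace (t + 1 + INR i) with (t + (INR i + 1)) by ring. }
  assert (E : a (S k) = a 0%nat).
  { unfold a; fold d; simpl (INR 0).
    replace ((t + d) / d) with ((t + 0) / d + 1) by (field; exact Hd).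
    now rewrite !CT_periodic. }
  apply (plus_reg_l (a 0%nat)).
  assert (H : sum_n a (S k) = plus (a 0%nat) (sum_n (fun i => a (S i)) k)).
  { unfold sum_n; rewrite (sum_Sn_m a 0 (S k)) by lia; f_equal.
    now rewrite <- (sum_n_m_S a 0 k). }
  refine (eq_trans (eq_sym H) _); rewrite sum_Sn, E; apply plus_comm.
Qed.

Lemma transfer_continuous (d : nat) (f u : CT) (t : R) :
  continuous (transfer_fun d f u) t.
Proof.
assert (A : forall i s, continuous (fun s => (s + INR i) / INR d) s).
{ intros i s; apply (continuous_mult (K := R_AbsRing) (fun s => s + INR i)).
  - apply (continuous_plus (V := R_NormedModule) (fun s => s));
      [apply continuous_id|apply continuous_const].
  - apply continuous_const. }
unfold transfer_fun; apply continuous_Cmult; [apply continuous_const|].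
generalize (pred d); intros k; induction k as [|k IH].
- apply (continuous_ext
    (fun t => (f ((t + INR 0) / INR d)%R * u ((t + INR 0) / INR d)%R)%C)).
  + intros s; now rewrite sum_O.
  + apply continuous_Cmult;
    apply (continuous_comp (fun s => (s + INR 0) / INR d)); try apply A;
    apply CT_continuous.
- apply (continuous_ext
    (fun t => plus
      (sum_n (fun i => (f ((t + INR i) / INR d)%R * u ((t + INR i) / INR d)%R)%C) k)
      (f ((t + INR (S k)) / INR d)%R * u ((t + INR (S k)) / INR d)%R)%C)).
  + intros s; now rewrite sum_Sn.
  + apply (continuous_plus (V := C_NormedModule)); [exact IH|].
    apply continuous_Cmult;
    apply (continuous_comp (fun s => (s + INR (S k)) / INR d)); try apply A;
    apply CT_continuous.
Qed.

Definition transfer (d : nat) (f u : CT) : CT :=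
  mkCT (transfer_fun d f u) (transfer_periodic d f u) (transfer_continuous d f u).

(* The n-th root of x >= 0, for n >= 1; [Rpower 0 y] is not 0. *)
Definition nth_root (n : nat) (x : R) : R :=
  if Req_dec_T x 0 then 0 else Rpower x (/ INR n).

(* L^n 1 is real-valued when f is, so taking the real part loses nothing. *)

Definition iter_one (d : nat) (f : CT) (n : nat) (t : R) : R :=
  Re (Nat.iter n (transfer d f) (CT_const 1%C) t).

Definition lower_root (d : nat) (f : CT) (n : nat) : R :=
  nth_root n (Tmin (iter_one d f n)).

Definition upper_root (d : nat) (f : CT) (n : nat) : R :=
  nth_root n (Tmax (iter_one d f n)).

Fixpoint Cprod (a : nat -> C) (n : nat) : C :=
  match n with
  | O => 1%C
  | S k => (Cprod a k * a k)%C
  end.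

Definition I_int (d : nat) (f : CT) (n : nat) : C :=
  RInt (V := C_R_CompleteNormedModule)
    (fun t => Cprod (fun j => f (INR d ^ j * t)) n) 0 1.

Definition I_root (d : nat) (f : CT) (n : nat) : R :=
  nth_root n (Cmod (I_int d f n)).

Definition lower_rate (d : nat) (f : CT) : Rbar := Lim_seq (lower_root d f).
Definition upper_rate (d : nat) (f : CT) : Rbar := Lim_seq (upper_root d f).
Definition c_rate (d : nat) (f : CT) : Rbar := LimSup_seq (I_root d f).

(* Main.v *)
Require Import Defs.
From Stdlib Require Import Reals Lra Lia Classical ClassicalEpsilon.
From Coquelicot Require Import Coquelicot.
Open Scope R_scope.

(* Everything follows from a continuous [g > 0] with [L g = rho g]: then
   [c rho^n <= L^n 1 <= rho^n / c], also [I_n] is the integral of [L^n 1], and in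
   the weighted norm [sup |u| / g] the operator [L] has norm [rho], so that its
   spectral radius is [rho].

   To find [g], let [rho] be the exponential growth rate of [max L^n 1]. The sums
   [h_N] of [rho^-n L^n 1] over [n <= N] satisfy [L h_N >= rho (h_N - 1)] and are
   unbounded. Since [L] contracts moduli of continuity by [d^-alpha], a
   Lasota-Yorke estimate bounds the Hoelder constant of [h_N] by a multiple of
   [max h_N]. The normalized [h_N] are thus equicontinuous almost-subsolutions,
   and in the limit they give [g >= 0], [g <> 0] with [L g >= rho g]. If
   [L g <> rho g], the Krein property makes [L^n (L g - rho g)] positive for
   some [n], which forces growth faster than [rho]; so [L g = rho g], and the
   Krein property applied to [g] gives [g > 0]. *)

(** * Powers, roots and growth rates of submultiplicative sequences *)

Lemma pow_le_reg (x y : R) (n : nat) : (0 < n)%nat -> 0 <= y -> x ^ n <= y ^ n -> x <= y.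
Proof.
intros Hn Hy H; destruct (Rle_or_lt x y) as [|Hlt]; [assumption|exfalso].
destruct n as [|n]; [lia|]; simpl in H.
assert (H1 : y ^ n <= x ^ n) by (apply pow_incr; lra).
assert (H2 : 0 < x ^ n) by (apply pow_lt; lra).
assert (H3 : 0 <= y ^ n) by now apply pow_le.
nra.
Qed.

(** If [p < q], then [(p / q) ^ k] tends to 0 and drops below [delta]. This removes constant factors
    from comparisons of growth rates. *)
Lemma geometric_dominated (delta q p : R) :
  0 < delta -> 0 <= q -> 0 <= p -> (forall k, delta * q ^ k <= p ^ k) -> q <= p.
Proof.
intros Hd Hq Hp H; destruct (Rle_or_lt q p) as [|Hlt]; [assumption|exfalso].
assert (Hq' : 0 < q) by lra.
destruct (pow_lt_1_zero (p / q)) with (y := delta) as [N HN]; [|exact Hd|].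
- rewrite Rabs_pos_eq; [|apply Rle_mult_inv_pos; lra].
  apply (Rmult_lt_reg_r q); [lra|]; unfold Rdiv; rewrite Rmult_assoc, Rinv_l; lra.
- specialize (HN N (le_n N)); specialize (H N).
  rewrite Rabs_pos_eq in HN by (apply pow_le, Rle_mult_inv_pos; lra).
  assert (Hk : 0 < q ^ N) by now apply pow_lt.
  unfold Rdiv in HN; rewrite Rpow_mult_distr, pow_inv in HN.
  apply (Rmult_lt_compat_r (q ^ N)) in HN; [|exact Hk].
  rewrite Rmult_assoc, Rinv_l in HN; lra.
Qed.

Lemma root_pow (x : R) (n : nat) : 0 < x -> (0 < n)%nat -> Rpower x (/ INR n) ^ n = x.
Proof.
intros Hx Hn; rewrite <- Rpower_pow by apply exp_pos.
rewrite Rpower_mult, Rinv_l by (apply not_0_INR; lia).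
now apply Rpower_1.
Qed.

Lemma submultiplicative_pow (a : nat -> R) :
  (forall n, 0 <= a n) -> a 0%nat <= 1 -> (forall n m, a (n + m)%nat <= a n * a m) ->
  forall p n, a (p * n)%nat <= a n ^ p.
Proof.
intros Ha H0 Hs p n; induction p as [|p IH]; simpl; [exact H0|].
apply Rle_trans with (1 := Hs n (p * n)%nat).
now apply Rmult_le_compat_l.
Qed.

(** The rate is the supremum of all [x >= 0] with [x ^ n <= a n] for every [n]. Maximality is the
    form needed later: each [y] above [rho] satisfies [a m < y ^ m] for some [m]. The lower bound
    along multiples of [p] makes the supremum positive. *)
Lemma submultiplicative_rate (a : nat -> R) (p : nat) (delta : R) :
  (forall n, 0 <= a n) -> a 0%nat <= 1 -> (forall n m, a (n + m)%nat <= a n * a m) ->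
  (0 < p)%nat -> 0 < delta -> (forall k, delta ^ k <= a (p * k)%nat) ->
  exists rho, 0 < rho /\ (forall n, rho ^ n <= a n) /\
    forall y, 0 <= y -> (forall n, y ^ n <= a n) -> y <= rho.
Proof.
intros Ha H0 Hs Hp Hdelta Hlow.
set (x0 := Rpower delta (/ INR p)).
(* Compare p-th powers: [(x0 ^ n) ^ p = delta ^ n <= a (p * n) <= a n ^ p]. *)
assert (Hx0 : forall n, x0 ^ n <= a n).
{ intros n; apply (pow_le_reg _ _ p Hp (Ha n)).
  rewrite <- pow_mult, Nat.mul_comm, pow_mult; unfold x0; rewrite root_pow by assumption.
  apply Rle_trans with (1 := Hlow n); now apply submultiplicative_pow. }
assert (Px0 : 0 < x0) by apply exp_pos.
destruct (completeness (fun x => 0 <= x /\ forall n, x ^ n <= a n)) as [rho [Hub Hlub]].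
- exists (a 1%nat); intros x [_ Hx]; specialize (Hx 1%nat); now rewrite pow_1 in Hx.
- exists x0; split; [lra|exact Hx0].
- assert (Hr : x0 <= rho) by (apply Hub; split; [lra|exact Hx0]).
  exists rho; split; [lra|split].
  + intros n; destruct n as [|n]; [apply (Hx0 0%nat)|].
    assert (Pa : 0 < a (S n)).
    { apply Rlt_le_trans with (2 := Hx0 (S n)); now apply pow_lt. }
    rewrite <- (root_pow (a (S n)) (S n) Pa) by lia.
    apply pow_incr; split; [lra|].
    apply Hlub; intros x [_ Hx2].
    apply (pow_le_reg _ _ (S n)); [lia|apply Rlt_le, exp_pos|].
    rewrite root_pow by (assumption || lia); apply Hx2.
  + intros y Hy0 Hy; apply Hub; now split.
Qed.

Lemma Lub_real_correct (E : R -> Prop) (x M : R) :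
  E x -> (forall y, E y -> y <= M) -> is_lub E (real (Lub_Rbar E)).
Proof.
intros Hx HM; destruct (Lub_Rbar_correct E) as [H1 H2].
destruct (Lub_Rbar E) as [l| |].
- split; [exact H1|].
  intros b Hb; apply (H2 (Finite b)); exact Hb.
- exfalso; apply (H2 (Finite M)); exact HM.
- exfalso; apply (H1 x Hx).
Qed.

(** The minimum of finitely many thresholds works for all of them. It serves for the [d] preimages
    of a point and for a finite grid on the unit interval. *)
Lemma common_threshold (n : nat) (P : nat -> R -> Prop) :
  (forall i e e', e' <= e -> P i e -> P i e') ->
  (forall i, (i <= n)%nat -> exists e, 0 < e /\ P i e) ->
  exists e, 0 < e /\ forall i, (i <= n)%nat -> P i e.
Proof.
intros Hm; induction n as [|n IH]; intros H.
- destruct (H 0%nat (le_n _)) as [e [He HP]]; exists e; split; [exact He|].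
  intros i Hi; now replace i with 0%nat by lia.
- destruct IH as [e1 [He1 H1]]; [intros i Hi; apply H; lia|].
  destruct (H (S n) (le_n _)) as [e2 [He2 H2]].
  exists (Rmin e1 e2); split; [now apply Rmin_pos|].
  intros i Hi; destruct (Nat.eq_dec i (S n)) as [->|Hne].
  + now apply Hm with (2 := H2), Rmin_r.
  + apply Hm with (2 := H1 i ltac:(lia)), Rmin_l.
Qed.

(** * Hoelder moduli and continuous functions on the circle *)

(** This is |x|^alpha with the value 0 put in by hand at 0, where [Rpower] gives 1; Hoelder bounds
    then hold at [s = t] as well. *)
Definition modulus (alpha x : R) : R :=
  if Req_dec_T x 0 then 0 else Rpower (Rabs x) alpha.

Lemma modulus_ge_0 alpha x : 0 <= modulus alpha x.
Proof. unfold modulus; destruct (Req_dec_T x 0); [lra|apply Rlt_le, exp_pos]. Qed.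

Lemma modulus_scal alpha c x : 0 < c ->
  modulus alpha (x * c) = Rpower c alpha * modulus alpha x.
Proof.
intros Hc; unfold modulus.
destruct (Req_dec_T x 0) as [->|Hx]; destruct (Req_dec_T _ 0) as [E|E].
- ring.
- exfalso; apply E; ring.
- exfalso; apply Rmult_integral in E; lra.
- rewrite Rabs_mult, (Rabs_pos_eq c) by lra.
  rewrite Rmult_comm; symmetry; apply Rpower_mult_distr; [assumption|now apply Rabs_pos_lt].
Qed.

Lemma modulus_small alpha eps : 0 < alpha -> 0 < eps ->
  exists delta, 0 < delta /\ forall x, Rabs x < delta -> modulus alpha x < eps.
Proof.
intros Ha He; exists (Rpower eps (/ alpha)); split; [apply exp_pos|].
intros x Hx; unfold modulus; destruct (Req_dec_T x 0) as [|Hne]; [assumption|].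
replace eps with (Rpower (Rpower eps (/ alpha)) alpha).
- apply Rlt_Rpower_l; [assumption|split; [now apply Rabs_pos_lt|assumption]].
- rewrite Rpower_mult, Rinv_l by lra; now apply Rpower_1.
Qed.

Definition hol (alpha B : R) (u : R -> R) : Prop :=
  forall s t, Rabs (u s - u t) <= B * modulus alpha (s - t).

Lemma hol_continuous alpha B u t : 0 < alpha -> hol alpha B u -> continuous u t.
Proof.
intros Ha H; apply continuity_pt_filterlim; intros eps Heps.
destruct (modulus_small alpha (eps / (Rabs B + 1))) as [delta [Hd Hm]]; [assumption| |].
{ apply Rdiv_lt_0_compat; [assumption|]; pose proof (Rabs_pos B); lra. }
exists delta; split; [exact Hd|]; intros s [_ Hs].
change (Rabs (s - t) < delta) in Hs; change (Rabs (u s - u t) < eps).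
apply Rle_lt_trans with (1 := H s t); specialize (Hm _ Hs).
pose proof (modulus_ge_0 alpha (s - t)); pose proof (Rle_abs B); pose proof (Rabs_pos B).
apply Rle_lt_trans with ((Rabs B + 1) * modulus alpha (s - t)); [nra|].
apply (Rmult_lt_compat_l (Rabs B + 1)) in Hm; [|lra].
replace ((Rabs B + 1) * (eps / (Rabs B + 1))) with eps in Hm by (field; lra); lra.
Qed.
Definition torus_cont (u : R -> R) : Prop :=
  (forall t, u (t + 1) = u t) /\ forall t, continuous u t.

Lemma torus_max (u : R -> R) : torus_cont u -> exists t, Tmax u = u t /\ forall s, u s <= u t.
Proof. intros [Hp Hc]; now apply Tmax_attained. Qed.

Lemma torus_min (u : R -> R) : torus_cont u -> exists t, Tmin u = u t /\ forall s, u t <= u s.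
Proof. intros [Hp Hc]; now apply Tmin_attained. Qed.

Lemma torus_cont_const c : torus_cont (fun _ => c).
Proof. split; [reflexivity|intros t; apply continuous_const]. Qed.

Lemma torus_cont_plus u v : torus_cont u -> torus_cont v -> torus_cont (fun t => u t + v t).
Proof.
intros [Pu Cu] [Pv Cv]; split.
- intros t; now rewrite Pu, Pv.
- intros t; now apply (continuous_plus (V := R_NormedModule) u v).
Qed.

Lemma torus_cont_scal c u : torus_cont u -> torus_cont (fun t => c * u t).
Proof.
intros [Pu Cu]; split.
- intros t; now rewrite Pu.
- intros t; apply (continuous_scal_r (V := R_NormedModule) c u), Cu.
Qed.

(** * The real transfer operator: positivity, linearity and iterates *)

Section Operator.

Variables (d : nat) (phi : R -> R).
Hypothesis d_ge_2 : (2 <= d)%nat.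
Hypothesis phi_cont : torus_cont phi.
Hypothesis phi_ge_0 : forall t, 0 <= phi t.

Definition preimage (t : R) (i : nat) : R := (t + INR i) / INR d.

Definition rtransfer (u : R -> R) (t : R) : R :=
  / INR d * sum_f_R0 (fun i => phi (preimage t i) * u (preimage t i)) (pred d).

Lemma INR_d_ge_2 : 2 <= INR d.
Proof. apply (le_INR 2), d_ge_2. Qed.

(** Monotonicity at a single point: for the envelope below, the comparison is known only at the
    preimages of one [t]. *)
Lemma rtransfer_le_at (u v : R -> R) t :
  (forall i, (i <= pred d)%nat -> u (preimage t i) <= v (preimage t i)) ->
  rtransfer u t <= rtransfer v t.
Proof.
intros H; unfold rtransfer; pose proof INR_d_ge_2.
apply Rmult_le_compat_l; [apply Rlt_le, Rinv_0_lt_compat; lra|].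
apply sum_Rle; intros i Hi; apply Rmult_le_compat_l; auto.
Qed.

Lemma rtransfer_le (u v : R -> R) :
  (forall t, u t <= v t) -> forall t, rtransfer u t <= rtransfer v t.
Proof. intros H t; apply rtransfer_le_at; auto. Qed.

Lemma rtransfer_ext (u v : R -> R) :
  (forall t, u t = v t) -> forall t, rtransfer u t = rtransfer v t.
Proof.
intros H t; apply Rle_antisym; apply rtransfer_le; intros s; rewrite H; lra.
Qed.

Lemma rtransfer_lin a b (u v : R -> R) t :
  rtransfer (fun s => a * u s + b * v s) t = a * rtransfer u t + b * rtransfer v t.
Proof.
unfold rtransfer; rewrite (sum_eq _ (fun i =>
  a * (phi (preimage t i) * u (preimage t i)) + b * (phi (preimage t i) * v (preimage t i))))
  by (intros; ring).
induction (pred d) as [|n IH]; simpl; [ring|].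
rewrite Rmult_plus_distr_l, IH; ring.
Qed.

Lemma rtransfer_scal a (u : R -> R) t : rtransfer (fun s => a * u s) t = a * rtransfer u t.
Proof.
rewrite (rtransfer_ext _ (fun s => a * u s + 0 * u s)) by (intros; ring).
rewrite rtransfer_lin; ring.
Qed.

Lemma rtransfer_shift c a (u : R -> R) t :
  rtransfer (fun s => c + a * u s) t = c * rtransfer (fun _ => 1) t + a * rtransfer u t.
Proof.
rewrite (rtransfer_ext _ (fun s => c * 1 + a * u s)) by (intros; ring).
apply (rtransfer_lin c a (fun _ => 1)).
Qed.

Lemma rtransfer_ge_0 (u : R -> R) : (forall t, 0 <= u t) -> forall t, 0 <= rtransfer u t.
Proof.
intros H t; rewrite <- (Rmult_0_l (rtransfer u t)), <- rtransfer_scal.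
apply rtransfer_le; intros s; rewrite Rmult_0_l; apply H.
Qed.

Definition riter (n : nat) (u : R -> R) : R -> R := Nat.iter n rtransfer u.

Lemma riter_S n u t : riter (S n) u t = rtransfer (riter n u) t.
Proof. reflexivity. Qed.

Lemma riter_add n m u : riter (n + m) u = riter n (riter m u).
Proof. unfold riter; apply Nat.iter_add. Qed.

Lemma riter_le n (u v : R -> R) :
  (forall t, u t <= v t) -> forall t, riter n u t <= riter n v t.
Proof. intros H; induction n as [|n IH]; [exact H|]; now apply rtransfer_le. Qed.

Lemma riter_scal n a (u : R -> R) t : riter n (fun s => a * u s) t = a * riter n u t.
Proof.
revert t; induction n as [|n IH]; intros t; [reflexivity|].
rewrite !riter_S, <- rtransfer_scal; now apply rtransfer_ext.
Qed.

Lemma riter_ge_0 n (u : R -> R) : (forall t, 0 <= u t) -> forall t, 0 <= riter n u t.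
Proof. intros H; induction n as [|n IH]; [exact H|]; now apply rtransfer_ge_0. Qed.

Lemma riter_ge_geom n c (u : R -> R) : 0 <= c ->
  (forall t, c * u t <= rtransfer u t) -> forall t, c ^ n * u t <= riter n u t.
Proof.
intros Hc H; induction n as [|n IH]; intros t; [simpl; lra|].
rewrite riter_S; apply Rle_trans with (2 := rtransfer_le _ _ IH t).
rewrite rtransfer_scal; simpl.
rewrite (Rmult_comm c), Rmult_assoc; apply Rmult_le_compat_l; [now apply pow_le|apply H].
Qed.

Lemma torus_cont_rtransfer u : torus_cont u -> torus_cont (rtransfer u).
Proof.
intros [Pu Cu]; destruct phi_cont as [Pp Cp]; pose proof INR_d_ge_2 as Hd; split.
- intros t; unfold rtransfer; f_equal.
  set (a := fun i => phi (preimage t i) * u (preimage t i)).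
  rewrite (sum_eq _ (fun i => a (S i))).
  2:{ intros i _; unfold a; replace (preimage (t + 1) i) with (preimage t (S i)).
      - reflexivity.
      - unfold preimage; rewrite S_INR; f_equal; ring. }
  (* Moving [t] by 1 sends branch [i] to branch [i + 1]; the branch [d] that enters is branch 0
     moved by 1, so the sum is unchanged. *)
  assert (E : a d = a 0%nat).
  { unfold a; replace (preimage t d) with (preimage t 0 + 1).
    - now rewrite Pp, Pu.
    - unfold preimage; simpl (INR 0); field; lra. }
  destruct d as [|k]; [lia|simpl pred].
  assert (E' := decomp_sum a (S k) ltac:(lia)); simpl in E'; rewrite E in E'; lra.
- intros t; apply (continuous_scal_r (V := R_NormedModule)).
  assert (A : forall i, continuous (fun s => preimage s i) t).
  { intros i; apply (continuous_mult (K := R_AbsRing) (fun s => s + INR i)).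
    - apply (continuous_plus (V := R_NormedModule) (fun s => s));
        [apply continuous_id|apply continuous_const].
    - apply continuous_const. }
  assert (B : forall i, continuous (fun s => phi (preimage s i) * u (preimage s i)) t).
  { intros i; apply (continuous_mult (K := R_AbsRing));
    apply (continuous_comp (fun s => preimage s i)); auto. }
  induction (pred d) as [|n IH]; [apply B|].
  simpl; now apply (continuous_plus (V := R_NormedModule)).
Qed.

Lemma torus_cont_riter n u : torus_cont u -> torus_cont (riter n u).
Proof. intros H; induction n; [exact H|now apply torus_cont_rtransfer]. Qed.

Definition sup_iter (n : nat) : R := Tmax (riter n (fun _ => 1)).

Lemma riter_one_cont n : torus_cont (riter n (fun _ => 1)).
Proof. apply torus_cont_riter, torus_cont_const. Qed.

Lemma riter_one_ge_0 n t : 0 <= riter n (fun _ => 1) t.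
Proof. apply riter_ge_0; intros; lra. Qed.

Lemma sup_iter_ge n t : riter n (fun _ => 1) t <= sup_iter n.
Proof. unfold sup_iter; destruct (torus_max _ (riter_one_cont n)) as [s [-> H]]; apply H. Qed.

Lemma sup_iter_le n M : (forall t, riter n (fun _ => 1) t <= M) -> sup_iter n <= M.
Proof. intros H; unfold sup_iter; destruct (torus_max _ (riter_one_cont n)) as [s [-> _]]; apply H. Qed.

Lemma sup_iter_ge_0 n : 0 <= sup_iter n.
Proof. apply Rle_trans with (1 := riter_one_ge_0 n 0), sup_iter_ge. Qed.

Lemma sup_iter_0 : sup_iter 0 = 1.
Proof.
apply Rle_antisym; [apply sup_iter_le; intros; simpl; lra|apply (sup_iter_ge 0 0)].
Qed.

Lemma riter_le_sup n M u t : (forall s, u s <= M) -> riter n u t <= M * riter n (fun _ => 1) t.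
Proof.
intros H; rewrite <- riter_scal; apply riter_le; intros s; rewrite Rmult_1_r; apply H.
Qed.

Lemma riter_ge_inf n c u t : (forall s, c <= u s) -> c * riter n (fun _ => 1) t <= riter n u t.
Proof.
intros H; rewrite <- riter_scal; apply riter_le; intros s; rewrite Rmult_1_r; apply H.
Qed.

Lemma sup_iter_submult n m : sup_iter (n + m) <= sup_iter n * sup_iter m.
Proof.
apply sup_iter_le; intros t; rewrite riter_add.
apply Rle_trans with (1 := riter_le_sup n (sup_iter m) _ t (sup_iter_ge m)).
rewrite Rmult_comm; apply Rmult_le_compat_r; [apply sup_iter_ge_0|apply sup_iter_ge].
Qed.


(** * The exponential growth rate *)

Definition real_krein : Prop := forall u, torus_cont u -> (forall t, 0 <= u t) ->
  (exists t, 0 < u t) -> exists n, forall t, 0 < riter n u t.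

(** The Krein property is applied to [sin^2 (PI t)], which lies between 0 and 1 and vanishes at 0.
    For some [p > 0] this gives [L^p 1 >= delta > 0], hence [L^(p k) 1 >= delta ^ k], which keeps
    the rate of [sup_iter] positive. *)
Lemma growth_rate_exists : real_krein -> exists rho, 0 < rho /\
  (forall n, rho ^ n <= sup_iter n) /\
  forall y, 0 <= y -> (forall n, y ^ n <= sup_iter n) -> y <= rho.
Proof.
intros Hk; set (u := fun t => Rsqr (sin (PI * t))).
assert (Cu : torus_cont u).
{ split; intros t; unfold u.
  - rewrite Rmult_plus_distr_l, Rmult_1_r, neg_sin; apply eq_sym, Rsqr_neg.
  - apply (ex_derive_continuous (K := R_AbsRing) (V := R_NormedModule)).
    unfold Rsqr; auto_derive; trivial. }
assert (Bu : forall t, 0 <= u t <= 1).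
{ intros t; unfold u; split; [apply Rle_0_sqr|].
  pose proof (sin2_cos2 (PI * t)); pose proof (Rle_0_sqr (cos (PI * t))); lra. }
destruct (Hk u Cu) as [p Hp]; [apply Bu| |].
{ exists (/ 2); unfold u; change (PI * / 2) with (PI / 2); rewrite sin_PI2; unfold Rsqr; lra. }
(* [krein] admits [n = 0]; the zero of [u] at [0] rules it out here. *)
assert (Pp : (0 < p)%nat).
{ destruct p; [|lia]; specialize (Hp 0); simpl in Hp; unfold u in Hp.
  rewrite Rmult_0_r, sin_0, Rsqr_0 in Hp; lra. }
destruct (torus_min _ (torus_cont_riter p u Cu)) as [t0 [_ Hmin]].
assert (P0 := Hp t0); set (delta := riter p u t0) in *.
assert (H1 : forall t, delta <= riter p (fun _ => 1) t).
{ intros t; apply Rle_trans with (1 := Hmin t), riter_le; apply Bu. }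
apply (submultiplicative_rate sup_iter p delta); try assumption.
- exact sup_iter_ge_0.
- rewrite sup_iter_0; lra.
- exact sup_iter_submult.
- intros k; apply Rle_trans with (2 := sup_iter_ge (p * k) 0); generalize 0.
  induction k as [|k IH]; intros t; [rewrite Nat.mul_0_r; simpl; lra|].
  rewrite Nat.mul_succ_r, Nat.add_comm, riter_add.
  apply Rle_trans with (2 := riter_ge_inf p (delta ^ k) _ t IH).
  simpl; rewrite Rmult_comm; apply Rmult_le_compat_l; [apply pow_le; lra|apply H1].
Qed.

(** * The Lasota-Yorke estimate *)

Variables (alpha K : R).
Hypothesis alpha_gt_0 : 0 < alpha.
Hypothesis K_ge_0 : 0 <= K.
Hypothesis phi_hol : hol alpha K phi.

Definition contraction : R := Rpower (/ INR d) alpha.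

Lemma contraction_bounds : 0 < contraction < 1.
Proof.
pose proof INR_d_ge_2; split; [apply exp_pos|].
unfold contraction, Rpower; rewrite <- exp_0; apply exp_increasing.
rewrite ln_Rinv by lra.
assert (H1 : 0 < ln (INR d)) by (rewrite <- ln_1; apply ln_increasing; lra).
nra.
Qed.

Lemma modulus_preimage s t i :
  modulus alpha (preimage s i - preimage t i) = contraction * modulus alpha (s - t).
Proof.
pose proof INR_d_ge_2; unfold contraction.
rewrite <- modulus_scal by (apply Rinv_0_lt_compat; lra).
f_equal; unfold preimage; field; lra.
Qed.

(* The weight [p] is carried along pointwise, so that iterating this estimate
   produces [riter n 1 s] and not [sup_iter 1 ^ n]. *)
Lemma rtransfer_modulus (v p : R -> R) B E M :
  (forall s t, Rabs (v s - v t) <= (B * p s + E) * modulus alpha (s - t)) ->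
  (forall t, Rabs (v t) <= M) ->
  forall s t, Rabs (rtransfer v s - rtransfer v t) <=
    contraction * (B * rtransfer p s + E * rtransfer (fun _ => 1) s + K * M)
    * modulus alpha (s - t).
Proof.
intros Hv HM s t; pose proof INR_d_ge_2 as Hd.
set (w := contraction * modulus alpha (s - t)).
apply Rle_trans with (/ INR d * sum_f_R0 (fun i =>
  w * (B * (phi (preimage s i) * p (preimage s i)) + E * (phi (preimage s i) * 1) + K * M))
  (pred d)).
- unfold rtransfer; rewrite <- Rmult_minus_distr_l, <- minus_sum, Rabs_mult.
  rewrite (Rabs_pos_eq (/ INR d)) by (apply Rlt_le, Rinv_0_lt_compat; lra).
  apply Rmult_le_compat_l; [apply Rlt_le, Rinv_0_lt_compat; lra|].
  apply Rle_trans with (1 := Rsum_abs _ _), sum_Rle; intros i _.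
  specialize (Hv (preimage s i) (preimage t i)).
  assert (Hphi := phi_hol (preimage s i) (preimage t i)).
  rewrite modulus_preimage in Hv, Hphi; fold w in Hv, Hphi.
  assert (P := phi_ge_0 (preimage s i)); specialize (HM (preimage t i)).
  set (x := phi (preimage s i)) in *; set (x' := phi (preimage t i)) in *.
  set (y := v (preimage s i)) in *; set (y' := v (preimage t i)) in *.
  replace (x * y - x' * y') with (x * (y - y') + (x - x') * y') by ring.
  apply Rle_trans with (1 := Rabs_triang _ _); rewrite !Rabs_mult, (Rabs_pos_eq x) by exact P.
  apply Rle_trans with (x * ((B * p (preimage s i) + E) * w) + K * w * M).
  + apply Rplus_le_compat; [now apply Rmult_le_compat_l|].
    apply Rmult_le_compat; auto using Rabs_pos.
  + right; ring.
- right; unfold rtransfer.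
  assert (S : forall n, sum_f_R0 (fun i =>
    w * (B * (phi (preimage s i) * p (preimage s i)) + E * (phi (preimage s i) * 1) + K * M)) n =
    w * (B * sum_f_R0 (fun i => phi (preimage s i) * p (preimage s i)) n
         + E * sum_f_R0 (fun i => phi (preimage s i) * 1) n + INR (S n) * (K * M))).
  { induction n as [|n IH]; [simpl; ring|].
    rewrite !tech5, IH, (S_INR (S n)); ring. }
  rewrite S; replace (Datatypes.S (pred d)) with d by lia.
  unfold w; field; lra.
Qed.

(** * Partial sums of the normalized iterates *)

Variable rho : R.
Hypothesis rho_gt_0 : 0 < rho.
Hypothesis rho_le : forall n, rho ^ n <= sup_iter n.
Hypothesis rho_max : forall y, 0 <= y -> (forall n, y ^ n <= sup_iter n) -> y <= rho.

(* [partial n] is the sum of [rho ^ -k L^k 1] over [k <= n]. *)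
Fixpoint partial (n : nat) : R -> R :=
  match n with
  | O => fun _ => 1
  | S k => fun t => 1 + / rho * rtransfer (partial k) t
  end.

Lemma partial_cont n : torus_cont (partial n).
Proof.
induction n as [|n IH]; [apply torus_cont_const|].
apply torus_cont_plus; [apply torus_cont_const|].
now apply torus_cont_scal, torus_cont_rtransfer.
Qed.

Lemma partial_le_S n t : partial n t <= partial (S n) t.
Proof.
assert (Hr := Rinv_0_lt_compat _ rho_gt_0).
revert t; induction n as [|n IH]; intros t.
- simpl; assert (0 <= rtransfer (fun _ => 1) t) by (apply rtransfer_ge_0; intros; lra); nra.
- change (1 + / rho * rtransfer (partial n) t <= 1 + / rho * rtransfer (partial (S n)) t).
  apply Rplus_le_compat_l, Rmult_le_compat_l; [lra|now apply rtransfer_le].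
Qed.

Lemma partial_le n m t : (n <= m)%nat -> partial n t <= partial m t.
Proof. induction 1 as [|m Hm IH]; [lra|]; apply Rle_trans with (1 := IH), partial_le_S. Qed.

Lemma partial_ge_1 n t : 1 <= partial n t.
Proof. apply (partial_le 0); lia. Qed.

Lemma rtransfer_partial n t : rtransfer (partial n) t = rho * (partial (S n) t - 1).
Proof. simpl; field; lra. Qed.

(** If [M] bounds all sums h_n, then [L h_n = rho (h_(n+1) - 1) <= rho (1 - 1/M) h_(n+1)]. Iterating
    from [h_0 = 1] gives [sup_iter k <= (rho (1 - 1/M))^k M], which is too small against
    [rho ^ k <= sup_iter k]. *)
Lemma partial_unbounded M : exists n t, M < partial n t.
Proof.
apply NNPP; intros Hno.
assert (HM : forall n t, partial n t <= M).
{ intros n t; destruct (Rle_or_lt (partial n t) M) as [|Hlt]; [assumption|].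
  exfalso; apply Hno; eauto. }
assert (M1 := HM 0%nat 0); simpl in M1.
assert (Mi := Rinv_0_lt_compat M ltac:(lra)).
assert (Mi1 : / M <= 1) by (rewrite <- Rinv_1; apply Rinv_le_contravar; lra).
assert (Hk : forall k n t, riter k (partial n) t <= (rho * (1 - / M)) ^ k * partial (k + n) t).
{ induction k as [|k IH]; intros n t; [simpl; lra|].
  rewrite riter_S; apply Rle_trans with (1 := rtransfer_le _ _ (IH n) t).
  rewrite rtransfer_scal, rtransfer_partial; simpl pow; rewrite (Rmult_comm (_ * _) (_ ^ k)).
  rewrite Rmult_assoc; apply Rmult_le_compat_l; [apply pow_le; nra|].
  rewrite Rmult_assoc; apply Rmult_le_compat_l; [lra|].
  change (S k + n)%nat with (S (k + n)); specialize (HM (S (k + n)) t).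
  apply (Rmult_le_compat_l (/ M)) in HM; [|lra].
  rewrite Rinv_l in HM; lra. }
assert (H : rho <= rho * (1 - / M)).
{ apply (geometric_dominated (/ M)); [lra|lra|nra|]; intros k.
  assert (Hs : sup_iter k <= (rho * (1 - / M)) ^ k * M).
  { apply sup_iter_le; intros t; apply Rle_trans with (1 := Hk k 0%nat t).
    apply Rmult_le_compat_l; [apply pow_le; nra|apply HM]. }
  assert (Hr := rho_le k).
  apply (Rmult_le_reg_l M); [lra|].
  rewrite <- Rmult_assoc, Rinv_r by lra; lra. }
nra.
Qed.

(** This is [rtransfer_modulus] iterated [j] times. The old Hoelder constant [B] is damped by
    [(contraction / rho) ^ j] times [L^j 1], and what each step adds is controlled by the sup bound
    [M], with [c] depending on [j] only. *)
Lemma partial_modulus j : exists c, 0 <= c /\ forall n B M, 0 <= B ->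
  hol alpha B (partial n) -> (forall t, partial (j + n) t <= M) ->
  forall s t, Rabs (partial (j + n) s - partial (j + n) t) <=
    ((contraction / rho) ^ j * B * riter j (fun _ => 1) s + c * M) * modulus alpha (s - t).
Proof.
pose proof contraction_bounds as Hc; assert (Hr := Rinv_0_lt_compat _ rho_gt_0).
induction j as [|j [c [Pc IH]]].
- exists 0; split; [lra|]; intros n B M HB H _ s t.
  apply Rle_trans with (1 := H s t); right; simpl; ring.
- assert (P1 := sup_iter_ge_0 1).
  exists (contraction / rho * (c * sup_iter 1 + K)); split.
  { apply Rmult_le_pos; [apply Rle_mult_inv_pos; lra|nra]. }
  intros n B M HB H HM s t.
  assert (HM' : forall t, partial (j + n) t <= M).
  { intros t'; apply Rle_trans with (2 := HM t'), partial_le; lia. }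
  assert (PM : 0 <= M) by (pose proof (HM' 0); pose proof (partial_ge_1 (j + n) 0); lra).
  assert (E := rtransfer_modulus (partial (j + n)) (riter j (fun _ => 1))
    ((contraction / rho) ^ j * B) (c * M) M (IH n B M HB H HM')).
  assert (E' : forall t, Rabs (partial (j + n) t) <= M).
  { intros t'; rewrite Rabs_pos_eq; [apply HM'|]; pose proof (partial_ge_1 (j + n) t'); lra. }
  specialize (E E' s t); clear E'.
  change (S j + n)%nat with (S (j + n)); simpl partial.
  match goal with |- Rabs ?x <= _ => replace x with
    (/ rho * (rtransfer (partial (j + n)) s - rtransfer (partial (j + n)) t)) by ring end.
  rewrite Rabs_mult, (Rabs_pos_eq (/ rho)) by lra.
  apply (Rmult_le_compat_l (/ rho)) in E; [|lra]; apply Rle_trans with (1 := E).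
  rewrite <- Rmult_assoc; apply Rmult_le_compat_r; [apply modulus_ge_0|].
  rewrite riter_S.
  assert (S1 : rtransfer (fun _ => 1) s <= sup_iter 1) by apply (sup_iter_ge 1).
  assert (T : c * M * rtransfer (fun _ => 1) s <= c * M * sup_iter 1)
    by (apply Rmult_le_compat_l; [apply Rmult_le_pos; lra|exact S1]).
  apply Rle_trans with (/ rho * (contraction * ((contraction / rho) ^ j * B *
     rtransfer (riter j (fun _ => 1)) s + c * M * sup_iter 1 + K * M))).
  + apply Rmult_le_compat_l; [lra|]; apply Rmult_le_compat_l; lra.
  + right; simpl; field; lra.
Qed.

(** Since [rho / contraction > rho], maximality of [rho] fails for it at some [m], that is,
    [sup_iter m < (rho / contraction) ^ m]. Over [m] steps the damping thus beats the growth of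
    [L^m 1]. *)
Lemma contracting_power : exists m, (0 < m)%nat /\ (contraction / rho) ^ m * sup_iter m < 1.
Proof.
pose proof contraction_bounds as Hc.
assert (Hy : rho < rho / contraction).
{ apply (Rmult_lt_reg_r contraction); [lra|].
  unfold Rdiv; rewrite Rmult_assoc, Rinv_l by lra; nra. }
destruct (not_all_ex_not nat (fun m => (rho / contraction) ^ m <= sup_iter m)) as [m Hm].
{ intros H; apply rho_max in H; lra. }
apply Rnot_le_lt in Hm; exists m; split.
- destruct m; [|lia]; rewrite sup_iter_0 in Hm; simpl in Hm; lra.
- replace (contraction / rho) with (/ (rho / contraction)) by (field; lra).
  assert (P : 0 < (rho / contraction) ^ m) by (apply pow_lt; lra).
  rewrite pow_inv; apply (Rmult_lt_reg_l ((rho / contraction) ^ m)); [exact P|].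
  rewrite <- Rmult_assoc, Rinv_r; lra.
Qed.

(** Each block of [m] steps changes the Hoelder constant from [B] to at most [q B + c M] with
    [q < 1], and [c M / (1 - q)] is the fixed point of this map. As the sums increase with [n], a
    bound [M] on the last one also bounds the earlier ones. *)
Lemma partial_hol : exists m H, (0 < m)%nat /\ 0 <= H /\ forall k M,
  (forall t, partial (k * m) t <= M) -> hol alpha (H * M) (partial (k * m)).
Proof.
destruct contracting_power as [m [Hm Hq]].
destruct (partial_modulus m) as [c [Pc Hc]].
pose proof contraction_bounds as Hct.
set (q := (contraction / rho) ^ m * sup_iter m) in *.
assert (Pm : 0 < (contraction / rho) ^ m) by (apply pow_lt, Rdiv_lt_0_compat; lra).
assert (PH : 0 <= c / (1 - q)) by (apply Rle_mult_inv_pos; lra).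
exists m, (c / (1 - q)); split; [exact Hm|split; [exact PH|]].
induction k as [|k IH]; intros M HM s t.
- simpl; rewrite Rminus_diag, Rabs_R0.
  assert (1 <= M) by apply (HM 0).
  apply Rmult_le_pos; [nra|apply modulus_ge_0].
- simpl Nat.mul in *.
  assert (HM' : forall t, partial (k * m) t <= M).
  { intros t'; apply Rle_trans with (2 := HM t'), partial_le; lia. }
  assert (PM : 0 <= M) by (pose proof (HM' 0); pose proof (partial_ge_1 (k * m) 0); lra).
  assert (PHM : 0 <= c / (1 - q) * M) by now apply Rmult_le_pos.
  apply Rle_trans with (1 := Hc (k * m)%nat _ M PHM (IH M HM') HM s t).
  apply Rmult_le_compat_r; [apply modulus_ge_0|].
  apply Rle_trans with (c / (1 - q) * M * q + c * M).
  + apply Rplus_le_compat_r; unfold q.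
    rewrite (Rmult_comm (_ ^ m) (_ * M)), Rmult_assoc; apply Rmult_le_compat_l; [exact PHM|].
    apply Rmult_le_compat_l; [lra|apply sup_iter_ge].
  + right; field; lra.
Qed.

(** * Almost-subsolutions and their limit *)

Definition almost_subsolution (H eps : R) (u : R -> R) : Prop :=
  (forall t, u (t + 1) = u t) /\ (forall t, 0 <= u t <= 1) /\ hol alpha H u /\
  forall t, rho * u t - eps <= rtransfer u t.

(** The functions are the partial sums divided by their maxima. That [H] is chosen before [eps] is
    the equicontinuity needed for the limit. *)
Lemma almost_subsolution_exists : exists H, 0 <= H /\ forall eps, 0 < eps ->
  exists u t, almost_subsolution H eps u /\ 0 <= t <= 1 /\ u t = 1.
Proof.
destruct partial_hol as [m [H [Hm [PH Hh]]]]; exists H; split; [exact PH|].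
intros eps Heps.
(* Dividing [L h >= rho h - rho] by a maximum above [rho / eps] brings the defect below [eps]. *)
destruct (partial_unbounded (rho / eps)) as [k [t1 Hk]].
(* The Hoelder bound is available at multiples of [m], so [k] is raised to [k * m]. *)
assert (Hkm : partial k t1 <= partial (k * m) t1) by (apply partial_le; nia).
destruct (torus_max _ (partial_cont (k * m))) as [t0 [_ Hmax]].
set (v := partial (k * m)) in *; set (M := v t0) in *.
assert (HM : rho / eps < M) by (specialize (Hmax t1); lra).
assert (M1 : 1 <= M) by apply partial_ge_1.
assert (Mi := Rinv_0_lt_compat M ltac:(lra)).
destruct (partial_cont (k * m)) as [Pv Cv]; fold v in Pv, Cv.
destruct (periodic_unit_interval v Pv t0) as [t2 [Ht2 Ev]].
exists (fun t => / M * v t), t2; split; [split; [|split; [|split]]|split].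
- intros t; now rewrite Pv.
- intros t; split; [assert (1 <= v t) by apply partial_ge_1; nra|].
  specialize (Hmax t); apply (Rmult_le_compat_l (/ M)) in Hmax; [|lra].
  rewrite Rinv_l in Hmax; lra.
- intros s t; rewrite <- Rmult_minus_distr_l, Rabs_mult, (Rabs_pos_eq (/ M)) by lra.
  assert (E := Hh k M Hmax s t); fold v in E.
  apply (Rmult_le_compat_l (/ M)) in E; [|lra].
  replace (/ M * (H * M * modulus alpha (s - t))) with (H * modulus alpha (s - t)) in E
    by (field; lra); exact E.
- intros t; rewrite rtransfer_scal; unfold v; rewrite rtransfer_partial; fold v.
  assert (v t <= partial (S (k * m)) t) by apply partial_le_S.
  assert (Hr : rho * / M <= eps).
  { apply (Rmult_le_reg_r M); [lra|]; rewrite Rmult_assoc, Rinv_l, Rmult_1_r by lra.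
    apply (Rmult_lt_compat_l eps) in HM; [|lra].
    replace (eps * (rho / eps)) with rho in HM by (field; lra); lra. }
  assert (0 < rho * / M) by now apply Rmult_lt_0_compat.
  apply Rle_trans with (rho * / M * (v t - 1)).
  + replace (rho * / M * (v t - 1)) with (rho * (/ M * v t) - rho * / M) by ring; lra.
  + replace (/ M * (rho * (partial (S (k * m)) t - 1))) with
      (rho * / M * (partial (S (k * m)) t - 1)) by ring.
    apply Rmult_le_compat_l; lra.
- exact Ht2.
- rewrite <- Ev; fold M; apply Rinv_l; lra.
Qed.

(* The upper envelope [inf_eps sup_u u t] of the almost-subsolutions replaces a
   uniform limit extracted by Arzela-Ascoli. *)
Definition envelope (H t : R) : R :=
  real (Lub_Rbar (fun y => forall eps, 0 < eps -> exists u, almost_subsolution H eps u /\ y <= u t)).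

Lemma almost_subsolution_mono H eps eps' u : eps <= eps' ->
  almost_subsolution H eps u -> almost_subsolution H eps' u.
Proof.
intros He [H1 [H2 [H3 H4]]]; split; [exact H1|split; [exact H2|split; [exact H3|]]].
intros t; specialize (H4 t); lra.
Qed.

Section Envelope.

Variable H : R.
Hypothesis H_ge_0 : 0 <= H.
Hypothesis H_exists : forall eps, 0 < eps ->
  exists u t, almost_subsolution H eps u /\ 0 <= t <= 1 /\ u t = 1.

Lemma envelope_lub t :
  is_lub (fun y => forall eps, 0 < eps -> exists u, almost_subsolution H eps u /\ y <= u t)
    (envelope H t).
Proof.
apply (Lub_real_correct _ 0 1).
- intros eps He; destruct (H_exists eps He) as [u [_ [Hu _]]]; exists u; split; [exact Hu|].
  apply Hu.
- intros y Hy; destruct (Hy 1 Rlt_0_1) as [u [[_ [Hu _]] Hle]]; specialize (Hu t); lra.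
Qed.

Lemma envelope_bounds t : 0 <= envelope H t <= 1.
Proof.
destruct (envelope_lub t) as [H1 H2]; split.
- apply H1; intros eps He; destruct (H_exists eps He) as [u [_ [Hu _]]]; exists u.
  split; [exact Hu|apply Hu].
- apply H2; intros y Hy; destruct (Hy 1 Rlt_0_1) as [u [[_ [Hu _]] Hle]]; specialize (Hu t); lra.
Qed.

Lemma envelope_below t y eps : y < envelope H t -> 0 < eps ->
  exists u, almost_subsolution H eps u /\ y <= u t.
Proof.
intros Hy He; apply NNPP; intros Hno.
destruct (envelope_lub t) as [_ H2]; apply (Rlt_not_le _ _ Hy), H2.
intros z Hz; destruct (Rle_or_lt z y) as [|Hlt]; [assumption|exfalso].
destruct (Hz eps He) as [u [Hu Hle]]; apply Hno; exists u; split; [exact Hu|lra].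
Qed.

Lemma envelope_above t y : envelope H t < y ->
  exists eps, 0 < eps /\ forall u, almost_subsolution H eps u -> u t < y.
Proof.
intros Hy; apply NNPP; intros Hno.
destruct (envelope_lub t) as [H1 _]; apply (Rlt_not_le _ _ Hy), H1.
intros eps He; apply NNPP; intros Hno'; apply Hno; exists eps; split; [exact He|].
intros u Hu; destruct (Rlt_or_le (u t) y) as [|Hle]; [assumption|exfalso].
apply Hno'; now exists u.
Qed.

(** An almost-subsolution that nearly attains the envelope at [s] competes at [t] as well and loses
    at most [c] there. Both the Hoelder bound and the periodicity of the envelope come from this. *)
Lemma envelope_transport s t c :
  (forall eps u, almost_subsolution H eps u -> u s - u t <= c) ->
  envelope H s - envelope H t <= c.
Proof.
intros Hc; apply Rle_plus_epsilon; intros e He.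
assert (envelope H s - e - c <= envelope H t); [|lra].
apply (proj1 (envelope_lub t)); intros eps Heps.
destruct (envelope_below s (envelope H s - e) eps) as [u [Hu Hle]]; [lra|exact Heps|].
exists u; split; [exact Hu|]; specialize (Hc eps u Hu); lra.
Qed.

Lemma envelope_hol : hol alpha H (envelope H).
Proof.
intros s t; apply Rabs_le; split.
- enough (envelope H t - envelope H s <= H * modulus alpha (s - t)) by lra.
  apply envelope_transport; intros eps u [_ [_ [Hu _]]]; specialize (Hu s t).
  apply Rabs_le_between in Hu; lra.
- apply envelope_transport; intros eps u [_ [_ [Hu _]]]; specialize (Hu s t).
  apply Rabs_le_between in Hu; lra.
Qed.

Lemma envelope_cont : torus_cont (envelope H).
Proof.
split.
- intros t; apply Rle_antisym.
  + enough (envelope H (t + 1) - envelope H t <= 0) by lra.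
    apply envelope_transport; intros eps u [Hu _]; rewrite Hu; lra.
  + enough (envelope H t - envelope H (t + 1) <= 0) by lra.
    apply envelope_transport; intros eps u [Hu _]; rewrite Hu; lra.
- intros t; now apply (hol_continuous alpha H), envelope_hol.
Qed.

(** One [u] with a small defect nearly attains the envelope at [t], while at the finitely many
    preimages of [t] every such [u] stays below the envelope plus [e']. Hence [L u] at [t] is
    squeezed between the two sides. *)
Lemma envelope_subsolution t : rho * envelope H t <= rtransfer (envelope H) t.
Proof.
apply Rle_plus_epsilon; intros e He.
assert (P1 := sup_iter_ge_0 1).
(* Three errors add up to [e' * c = e]: [rho e'] from the near-attainment at [t], [e'] from the
   defect of [u], and [e' * sup_iter 1] from the preimages. *)
set (c := rho + 1 + sup_iter 1); assert (Pc : 0 < c) by (unfold c; lra).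
set (e' := e / c); assert (Pe : 0 < e') by (apply Rdiv_lt_0_compat; lra).
destruct (common_threshold (pred d)
  (fun i eps => forall u, almost_subsolution H eps u ->
     u (preimage t i) < envelope H (preimage t i) + e')) as [eps0 [Heps0 Habove]].
- intros i e1 e2 Hle Hu u Hu2; apply Hu; now apply almost_subsolution_mono with e2.
- intros i _; apply envelope_above; lra.
- destruct (envelope_below t (envelope H t - e') (Rmin eps0 e')) as [u [Hu Hle]];
    [lra|now apply Rmin_pos|].
  assert (U1 : rtransfer u t <= rtransfer (fun s => e' + 1 * envelope H s) t).
  { apply rtransfer_le_at; intros i Hi.
    assert (u (preimage t i) < envelope H (preimage t i) + e'); [|lra].
    apply Habove; [exact Hi|]; apply almost_subsolution_mono with (2 := Hu), Rmin_l. }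
  rewrite rtransfer_shift in U1.
  assert (S1 : rtransfer (fun _ => 1) t <= sup_iter 1) by apply (sup_iter_ge 1).
  assert (U2 : rho * u t - e' <= rtransfer u t).
  { apply (almost_subsolution_mono H (Rmin eps0 e') e'); [apply Rmin_r|exact Hu]. }
  assert (Ee : e = rho * e' + e' + e' * sup_iter 1) by (unfold e', c; field; unfold c in Pc; lra).
  assert (rho * (envelope H t - e') <= rho * u t) by (apply Rmult_le_compat_l; lra).
  assert (e' * rtransfer (fun _ => 1) t <= e' * sup_iter 1) by (apply Rmult_le_compat_l; lra).
  lra.
Qed.

(** If the envelope vanished, all almost-subsolutions of small defect would be below 1/2 on a fine
    grid of the unit interval. One of them equals 1 within [delta] of a grid point, and the common
    Hoelder constant forbids such a drop. *)
Lemma envelope_nonzero : exists t, 0 < envelope H t.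
Proof.
apply NNPP; intros Hno.
assert (Hz : forall t, envelope H t < / 2).
{ intros t; destruct (Rle_or_lt (envelope H t) 0) as [|Hlt]; [lra|].
  exfalso; apply Hno; now exists t. }
(* Chosen so that [H] times the modulus is below 1/2; [H + 1] allows for [H = 0]. *)
destruct (modulus_small alpha (/ (2 * (H + 1)))) as [delta [Pd Hd]]; [exact alpha_gt_0| |].
{ apply Rinv_0_lt_compat; lra. }
destruct (archimed_cor1 delta Pd) as [n [Hn Pn]].
assert (Pn' : 0 < INR n) by now apply lt_0_INR.
destruct (common_threshold n
  (fun i eps => forall u, almost_subsolution H eps u -> u (INR i / INR n) < / 2))
  as [eps0 [Heps0 Habove]].
- intros i e1 e2 Hle Hu u Hu2; apply Hu; now apply almost_subsolution_mono with e2.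
- intros i _; now apply envelope_above.
- destruct (H_exists eps0 Heps0) as [u [t [Hu [Ht Eu]]]].
  destruct (nfloor_ex (t * INR n)) as [i [Hi1 Hi2]]; [nra|].
  assert (Hin : (i <= n)%nat) by (apply INR_le; nra).
  specialize (Habove i Hin u Hu).
  destruct Hu as [_ [_ [Hu _]]]; specialize (Hu t (INR i / INR n)).
  rewrite Eu in Hu; apply Rabs_le_between in Hu.
  assert (Hdist : Rabs (t - INR i / INR n) < delta).
  { replace (t - INR i / INR n) with ((t * INR n - INR i) * / INR n) by (field; lra).
    apply Rinv_0_lt_compat in Pn'; rewrite Rabs_pos_eq by nra; nra. }
  apply Hd in Hdist.
  pose proof (modulus_ge_0 alpha (t - INR i / INR n)).
  apply (Rmult_lt_compat_l (H + 1)) in Hdist; [|lra].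
  replace ((H + 1) * / (2 * (H + 1))) with (/ 2) in Hdist by (field; lra).
  lra.
Qed.

End Envelope.

Lemma subsolution_exists : exists g, torus_cont g /\ (forall t, 0 <= g t <= 1) /\
  (exists t, 0 < g t) /\ forall t, rho * g t <= rtransfer g t.
Proof.
destruct almost_subsolution_exists as [H [PH HE]]; exists (envelope H).
split; [|split; [|split]].
- now apply envelope_cont.
- now apply envelope_bounds.
- now apply envelope_nonzero.
- now apply envelope_subsolution.
Qed.

(** * From a subsolution to a positive eigenfunction *)

Lemma riter_residual n g t :
  riter n (fun s => 1 * rtransfer g s + - rho * g s) t
  = rtransfer (riter n g) t - rho * riter n g t.
Proof.
revert t; induction n as [|n IH]; intros t; [simpl; ring|].
rewrite riter_S, (rtransfer_ext _ (fun s => 1 * rtransfer (riter n g) s + - rho * riter n g s)).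
- rewrite rtransfer_lin; simpl; ring.
- intros s; rewrite IH; ring.
Qed.

(** Otherwise the Krein property gives [L^n (L g - rho g) >= c > 0]. Then [w = L^n g] satisfies
    [L w >= rho w + c >= (rho + c / M) w] with [M] an upper bound of [w], a growth faster than
    [rho]. *)
Lemma subsolution_is_eigenfunction g : real_krein -> torus_cont g ->
  (forall t, 0 <= g t <= 1) -> (forall t, rho * g t <= rtransfer g t) ->
  forall t, rtransfer g t = rho * g t.
Proof.
intros Hk Cg Bg Hg t; apply Rle_antisym; [|apply Hg].
apply Rnot_lt_le; intros Hlt.
set (u := fun s => 1 * rtransfer g s + - rho * g s).
assert (Cu : torus_cont u).
{ apply torus_cont_plus; apply torus_cont_scal; [now apply torus_cont_rtransfer|exact Cg]. }
destruct (Hk u Cu) as [n Hn].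
{ intros s; unfold u; specialize (Hg s); lra. }
{ exists t; unfold u; lra. }
destruct (torus_min _ (torus_cont_riter n u Cu)) as [t0 [_ Hmin]].
assert (Pc := Hn t0); set (c := riter n u t0) in *.
set (w := riter n g).
assert (Hw : forall s, rho * w s + c <= rtransfer w s).
{ intros s; specialize (Hmin s); unfold u in Hmin; rewrite riter_residual in Hmin.
  fold w in Hmin; lra. }
assert (Pw : forall s, 0 <= w s) by (intros s; apply riter_ge_0; apply Bg).
(* As [g <= 1], [sup_iter n] already bounds [w]; the added 1 makes [M] positive. *)
set (M := sup_iter n + 1).
assert (PM : 0 < M) by (unfold M; pose proof (sup_iter_ge_0 n); lra).
assert (HwM : forall s, w s <= M).
{ intros s; apply Rle_trans with (1 := riter_le _ g (fun _ => 1) (fun s => proj2 (Bg s)) s).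
  unfold M; pose proof (sup_iter_ge n s); lra. }
(* If [w] vanished, then [L w <= 0], against [L w >= c]. *)
destruct (not_all_ex_not R (fun s => w s <= 0)) as [t1 Ht1].
{ intros Hz; assert (E := rtransfer_le w (fun s => 0 * w s)).
  assert (E' : rtransfer w t <= rtransfer (fun s => 0 * w s) t).
  { apply E; intros s; specialize (Hz s); lra. }
  rewrite rtransfer_scal in E'; specialize (Hw t); specialize (Pw t); nra. }
apply Rnot_le_lt in Ht1.
set (y := rho + c / M).
assert (Py : rho < y) by (unfold y; pose proof (Rdiv_lt_0_compat c M Pc PM); lra).
assert (Hy : forall s, y * w s <= rtransfer w s).
{ intros s; apply Rle_trans with (2 := Hw s); unfold y; specialize (HwM s).
  assert (c / M * w s <= c / M * M)
    by (apply Rmult_le_compat_l; [apply Rlt_le, Rdiv_lt_0_compat|]; assumption).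
  replace (c / M * M) with c in * by (field; lra); lra. }
apply (Rlt_not_le _ _ Py), rho_max; [lra|]; intros m.
(* From [y^j w(t1) <= L^j w(t1) <= M * sup_iter j] at [j = k * m], letting [k] grow disposes of the
   constant [w t1 / M]. *)
apply (geometric_dominated (w t1 / M)).
- now apply Rdiv_lt_0_compat.
- apply pow_le; lra.
- apply sup_iter_ge_0.
- intros k; apply Rle_trans with (sup_iter (k * m)).
  + rewrite <- pow_mult, Nat.mul_comm.
    assert (E1 := riter_ge_geom (k * m) y w ltac:(lra) Hy t1).
    assert (E2 := riter_le_sup (k * m) M w t1 HwM).
    assert (E3 := sup_iter_ge (k * m) t1).
    apply (Rmult_le_compat_l M) in E3; [|lra].
    apply (Rmult_le_reg_l M); [lra|].
    replace (M * (w t1 / M * y ^ (k * m))) with (y ^ (k * m) * w t1) by (field; lra); lra.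
  + apply submultiplicative_pow; [exact sup_iter_ge_0|rewrite sup_iter_0; lra|
      exact sup_iter_submult].
Qed.

Lemma riter_eigen g n t : (forall s, rtransfer g s = rho * g s) -> riter n g t = rho ^ n * g t.
Proof.
intros H; revert t; induction n as [|n IH]; intros t; [simpl; ring|].
rewrite riter_S, (rtransfer_ext _ _ IH), rtransfer_scal, H; simpl; ring.
Qed.

(** Some [L^n g = rho^n g] is strictly positive by the Krein property, so [g] is; its minimum serves
    as [c]. *)
Lemma positive_eigenfunction_exists : real_krein -> exists g c, torus_cont g /\ 0 < c /\
  (forall t, c <= g t <= 1) /\ forall t, rtransfer g t = rho * g t.
Proof.
intros Hk; destruct subsolution_exists as [g [Cg [Bg [Ng Hg]]]].
assert (Eg := subsolution_is_eigenfunction g Hk Cg Bg Hg).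
destruct (Hk g Cg (fun t => proj1 (Bg t)) Ng) as [n Hn].
destruct (torus_min g Cg) as [t0 [_ Hmin]].
exists g, (g t0); split; [exact Cg|split; [|split; [|exact Eg]]].
- specialize (Hn t0); rewrite riter_eigen in Hn by exact Eg.
  pose proof (pow_lt rho n rho_gt_0); pose proof (Bg t0); nra.
- intros t; split; [apply Hmin|apply Bg].
Qed.

End Operator.

Lemma perron_pair (d : nat) (phi : R -> R) (alpha K : R) :
  (2 <= d)%nat -> torus_cont phi -> (forall t, 0 <= phi t) ->
  0 < alpha -> 0 <= K -> hol alpha K phi -> real_krein d phi ->
  exists rho g c, 0 < rho /\ torus_cont g /\ 0 < c /\
    (forall t, c <= g t <= 1) /\ forall t, rtransfer d phi g t = rho * g t.
Proof.
intros Hd Cphi Pphi Ha HK Hh Hk.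
destruct (growth_rate_exists d phi Hd Cphi Pphi Hk) as [rho [H1 [H2 H3]]].
exists rho; destruct (positive_eigenfunction_exists d phi Hd Cphi Pphi alpha K Ha HK Hh rho H1 H2 H3 Hk)
  as [g [c H]]; exists g, c; now split.
Qed.

(** * Limits of n-th roots *)

Lemma nth_root_lim (x : nat -> R) (rho a b : R) : 0 < rho -> 0 < a -> 0 < b ->
  (forall n, a * rho ^ n <= x n <= b * rho ^ n) ->
  is_lim_seq (fun n => nth_root n (x n)) rho.
Proof.
intros Hr Ha Hb Hx.
assert (Hpos : forall n, 0 < a * rho ^ n)
  by (intros n; apply Rmult_lt_0_compat; [assumption|now apply pow_lt]).
(* For [c > 0] and [n >= 1] this is the n-th root of [c * rho ^ n]; the sequence is squeezed between
   the cases [c = a] and [c = b]. *)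
assert (Hlim : forall c, is_lim_seq (fun n => exp (ln c * / INR n + ln rho)) rho).
{ intros c; replace (Finite rho) with (Finite (exp (ln rho))) by (f_equal; now apply exp_ln).
  apply (is_lim_seq_continuous exp (fun n => ln c * / INR n + ln rho) (ln rho)).
  - apply derivable_continuous_pt, derivable_pt_exp.
  - replace (Finite (ln rho)) with (Rbar_plus (Rbar_mult (ln c) 0) (ln rho))
      by (simpl; f_equal; ring).
    apply is_lim_seq_plus'; [|apply is_lim_seq_const].
    replace (ln c * 0) with (real (Rbar_mult (ln c) 0)) by (simpl; ring).
    apply (is_lim_seq_scal_l (fun n => / INR n) (ln c) 0).
    apply (is_lim_seq_inv INR p_infty); [apply is_lim_seq_INR|discriminate]. }
assert (Hexp : forall c n, 0 < c -> (0 < n)%nat ->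
  exp (ln c * / INR n + ln rho) = Rpower (c * rho ^ n) (/ INR n)).
{ intros c n Hc Hn; assert (Pn : 0 < INR n) by now apply lt_0_INR.
  unfold Rpower; rewrite ln_mult, ln_pow by (assumption || now apply pow_lt).
  f_equal; field; lra. }
apply is_lim_seq_le_le_loc with (2 := Hlim a) (3 := Hlim b).
exists 1%nat; intros n Hn; assert (Pn : 0 < INR n) by (apply lt_0_INR; lia).
specialize (Hx n); specialize (Hpos n).
assert (Hi : 0 < / INR n) by now apply Rinv_0_lt_compat.
rewrite !Hexp by (assumption || lia).
unfold nth_root; destruct (Req_dec_T (x n) 0) as [E|_]; [lra|].
split; apply Rle_Rpower_l; lra.
Qed.

(** * Birkhoff products and their integrals *)

Fixpoint rprod (a : nat -> R) (n : nat) : R :=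
  match n with
  | O => 1
  | S k => rprod a k * a k
  end.

Lemma rprod_ext a b n : (forall j, a j = b j) -> rprod a n = rprod b n.
Proof. intros H; induction n as [|n IH]; simpl; [reflexivity|now rewrite IH, H]. Qed.

Lemma rprod_S_l a n : rprod a (S n) = a 0%nat * rprod (fun j => a (S j)) n.
Proof.
induction n as [|n IH]; [simpl; ring|].
change (rprod a (S n) * a (S n) = a 0%nat * rprod (fun j => a (S j)) (S n)).
rewrite IH; simpl; ring.
Qed.

Lemma rprod_ge_0 a n : (forall j, 0 <= a j) -> 0 <= rprod a n.
Proof. intros H; induction n as [|n IH]; simpl; [lra|now apply Rmult_le_pos]. Qed.

Lemma Cprod_RtoC (a : nat -> C) (b : nat -> R) n :
  (forall j, a j = RtoC (b j)) -> Cprod a n = RtoC (rprod b n).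
Proof.
intros H; induction n as [|n IH]; simpl; [reflexivity|].
now rewrite IH, H, RtoC_mult.
Qed.

Lemma torus_cont_mult u v : torus_cont u -> torus_cont v -> torus_cont (fun t => u t * v t).
Proof.
intros [Pu Cu] [Pv Cv]; split.
- intros t; now rewrite Pu, Pv.
- intros t; now apply (continuous_mult (K := R_AbsRing) u v).
Qed.

Lemma torus_cont_dilate u k : torus_cont u -> torus_cont (fun t => u (INR k * t)).
Proof.
intros [Pu Cu]; split.
- intros t; rewrite Rmult_plus_distr_l, Rmult_1_r; now apply periodic_nat.
- intros t; apply (continuous_comp (fun t => INR k * t)); [|apply Cu].
  apply (continuous_scal_r (V := R_NormedModule) (INR k) (fun t => t)), continuous_id.
Qed.

Lemma torus_cont_RInt u a b : torus_cont u -> ex_RInt u a b.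
Proof. intros [_ Cu]; apply (ex_RInt_continuous (V := R_CompleteNormedModule)); auto. Qed.

Definition birkhoff_prod (d : nat) (phi : R -> R) (n : nat) (t : R) : R :=
  rprod (fun j => phi (INR d ^ j * t)) n.

Section Integral.

Variables (d : nat) (phi : R -> R).
Hypothesis d_ge_2 : (2 <= d)%nat.
Hypothesis phi_cont : torus_cont phi.
Hypothesis phi_ge_0 : forall t, 0 <= phi t.

Lemma birkhoff_prod_cont n : torus_cont (birkhoff_prod d phi n).
Proof.
induction n as [|n IH]; [apply torus_cont_const|].
apply torus_cont_mult; [exact IH|]; rewrite <- pow_INR; now apply torus_cont_dilate.
Qed.

Lemma birkhoff_prod_S n t :
  birkhoff_prod d phi (S n) t = phi t * birkhoff_prod d phi n (INR d * t).
Proof.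
unfold birkhoff_prod; rewrite rprod_S_l; f_equal.
- f_equal; simpl; ring.
- apply rprod_ext; intros j; f_equal; simpl; ring.
Qed.

Lemma birkhoff_prod_ge_0 n t : 0 <= birkhoff_prod d phi n t.
Proof. apply rprod_ge_0; auto. Qed.

(** Substituting [s = (t + i) / d] turns the i-th term into the integral of [G] over
    [[i/d, (i+1)/d]], and these intervals tile the unit interval. *)
Lemma RInt_branches (G : R -> R) : torus_cont G ->
  is_RInt (fun t => / INR d * sum_f_R0 (fun i => G (preimage d t i)) (pred d)) 0 1 (RInt G 0 1).
Proof.
intros CG; assert (Hd := INR_d_ge_2 d d_ge_2).
assert (B : forall i, is_RInt (fun t => / INR d * G (preimage d t i)) 0 1
  (RInt G (INR i / INR d) (INR (S i) / INR d))).
{ intros i; apply (is_RInt_ext (fun t => scal (/ INR d) (G (/ INR d * t + INR i / INR d)))).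
  - intros t _; unfold scal; simpl; unfold mult; simpl; f_equal; f_equal.
    unfold preimage; field; lra.
  - apply (is_RInt_comp_lin G).
    replace (/ INR d * 0 + INR i / INR d) with (INR i / INR d) by ring.
    replace (/ INR d * 1 + INR i / INR d) with (INR (S i) / INR d)
      by (rewrite S_INR; field; lra).
    apply (RInt_correct G), torus_cont_RInt, CG. }
assert (A : forall n,
  is_RInt (fun t => / INR d * sum_f_R0 (fun i => G (preimage d t i)) n) 0 1
    (RInt G 0 (INR (S n) / INR d))).
{ induction n as [|n IH].
  - specialize (B 0%nat); rewrite Rdiv_0_l in B; exact B.
  - rewrite <- (RInt_Chasles G 0 (INR (S n) / INR d)) by (apply torus_cont_RInt, CG).
    apply (is_RInt_ext (fun t => plus (/ INR d * sum_f_R0 (fun i => G (preimage d t i)) n)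
      (/ INR d * G (preimage d t (S n))))).
    + intros t _; simpl sum_f_R0; unfold plus; simpl; ring.
    + apply (is_RInt_plus (V := R_NormedModule)); [exact IH|apply B]. }
specialize (A (pred d)); replace (S (pred d)) with d in A by lia.
now replace (INR d / INR d) with 1 in A by (field; lra).
Qed.

(** At every preimage of [t] the argument [d s] equals [t] up to an integer, so the periodic factor
    [F] comes out of the sum over the branches. *)
Lemma RInt_transfer_dual (F v : R -> R) : torus_cont F -> torus_cont v ->
  RInt (fun t => phi t * F (INR d * t) * v t) 0 1 = RInt (fun t => F t * rtransfer d phi v t) 0 1.
Proof.
intros CF Cv; assert (Hd := INR_d_ge_2 d d_ge_2).
symmetry; apply is_RInt_unique.
eapply is_RInt_ext; [|apply RInt_branches].
- intros t _; unfold rtransfer; simpl.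
  rewrite (Rmult_comm (F t)), Rmult_assoc; f_equal.
  rewrite (Rmult_comm _ (F t)), scal_sum; apply sum_eq; intros i _.
  replace (INR d * preimage d t i) with (t + INR i) by (unfold preimage; field; lra).
  rewrite (periodic_nat F (proj1 CF)); ring.
- apply torus_cont_mult; [apply torus_cont_mult|]; auto; now apply torus_cont_dilate.
Qed.

(** Duality moves the first factor of the product onto [g] as one application of [L], which yields
    one factor [rho]. *)
Lemma RInt_birkhoff_eigen (rho : R) (g : R -> R) n : torus_cont g ->
  (forall t, rtransfer d phi g t = rho * g t) ->
  RInt (fun t => birkhoff_prod d phi n t * g t) 0 1 = rho ^ n * RInt g 0 1.
Proof.
intros Cg Eg; induction n as [|n IH].
- rewrite (RInt_ext _ g) by (intros; apply Rmult_1_l); symmetry; apply Rmult_1_l.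
- rewrite (RInt_ext _ (fun t => phi t * birkhoff_prod d phi n (INR d * t) * g t))
    by (intros; now rewrite birkhoff_prod_S).
  rewrite RInt_transfer_dual by (assumption || apply birkhoff_prod_cont).
  rewrite (RInt_ext _ (fun t => scal rho (birkhoff_prod d phi n t * g t))).
  + rewrite (RInt_scal (V := R_CompleteNormedModule)) by (apply torus_cont_RInt, torus_cont_mult;
      [apply birkhoff_prod_cont|exact Cg]).
    rewrite IH; symmetry; apply (Rmult_assoc rho).
  + intros t _; rewrite Eg, <- Rmult_assoc, (Rmult_comm _ rho); apply Rmult_assoc.
Qed.

(** Inserting the weight [g] changes the integral by a factor between [c] and 1, and the weighted
    integral is [rho ^ n] times that of [g], itself between [c] and 1. *)
Lemma RInt_birkhoff_bounds (rho c : R) (g : R -> R) n : torus_cont g ->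
  (forall t, rtransfer d phi g t = rho * g t) -> 0 < rho -> 0 < c -> (forall t, c <= g t <= 1) ->
  c * rho ^ n <= RInt (birkhoff_prod d phi n) 0 1 <= / c * rho ^ n.
Proof.
intros Cg Eg Hr Hc Bg.
assert (E := RInt_birkhoff_eigen rho g n Cg Eg).
assert (Pr : 0 < rho ^ n) by now apply pow_lt.
assert (CF := birkhoff_prod_cont n); assert (CFg := torus_cont_mult _ _ CF Cg).
assert (I1 : RInt (fun t => birkhoff_prod d phi n t * g t) 0 1 <= RInt (birkhoff_prod d phi n) 0 1).
{ apply RInt_le; [lra|now apply torus_cont_RInt|now apply torus_cont_RInt|].
  intros t _; pose proof (birkhoff_prod_ge_0 n t); specialize (Bg t); nra. }
assert (I2 : c * RInt (birkhoff_prod d phi n) 0 1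
  <= RInt (fun t => birkhoff_prod d phi n t * g t) 0 1).
{ change (scal c (RInt (birkhoff_prod d phi n) 0 1)
    <= RInt (fun t => birkhoff_prod d phi n t * g t) 0 1).
  rewrite <- (RInt_scal (V := R_CompleteNormedModule)) by now apply torus_cont_RInt.
  apply RInt_le; [lra|apply torus_cont_RInt; now apply torus_cont_scal|now apply torus_cont_RInt|].
  intros t _; change (c * birkhoff_prod d phi n t <= birkhoff_prod d phi n t * g t).
  pose proof (birkhoff_prod_ge_0 n t); specialize (Bg t); nra. }
assert (RC : forall x : R, RInt (V := R_CompleteNormedModule) (fun _ => x) 0 1 = x).
{ intros x; rewrite RInt_const; assert (Ex : (1 - 0) * x = x) by ring; exact Ex. }
assert (Gl : c <= RInt g 0 1).
{ apply Rle_trans with (1 := Req_le _ _ (eq_sym (RC c))), RInt_le;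
    [lra|apply ex_RInt_const|now apply torus_cont_RInt|intros; apply Bg]. }
assert (Gu : RInt g 0 1 <= 1).
{ apply Rle_trans with (2 := Req_le _ _ (RC 1)), RInt_le;
    [lra|now apply torus_cont_RInt|apply ex_RInt_const|intros; apply Bg]. }
rewrite E in I1, I2; split; [nra|].
apply (Rmult_le_reg_l c); [exact Hc|]; rewrite <- Rmult_assoc, Rinv_r by lra; nra.
Qed.

End Integral.

(** * Completeness of C(T) along geometric sequences *)

Lemma geometric_limit (u : nat -> R -> R) (M q : R) : 0 <= q < 1 ->
  (forall n t, continuous (u n) t) ->
  (forall n t, Rabs (u (S n) t - u n t) <= M * q ^ n) ->
  let l := fun t => real (Lim_seq (fun n => u n t)) in
  (forall n t, Rabs (l t - u n t) <= M / (1 - q) * q ^ n) /\ forall t, continuous l t.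
Proof.
intros Hq Cu Hu l.
assert (PM : 0 <= M).
{ specialize (Hu 0%nat 0); pose proof (Rabs_pos (u 1%nat 0 - u 0%nat 0)); simpl in Hu; lra. }
set (A := M / (1 - q)) in *; assert (PA : 0 <= A) by (apply Rle_mult_inv_pos; lra).
assert (H1 : forall k n t, Rabs (u (k + n)%nat t - u n t) <= A * q ^ n).
(* The exact geometric sum, [A (q^n - q^(k+n))], is what makes the induction on [k] close. *)
{ intros k n t; apply Rle_trans with (A * (q ^ n - q ^ (k + n))).
  - induction k as [|k IH]; [simpl; rewrite Rminus_diag, Rabs_R0; lra|].
    specialize (Hu (k + n)%nat t); change (S k + n)%nat with (S (k + n)).
    replace (u (S (k + n)) t - u n t)
      with ((u (S (k + n)) t - u (k + n)%nat t) + (u (k + n)%nat t - u n t)) by ring.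
    apply Rle_trans with (1 := Rabs_triang _ _).
    replace (A * (q ^ n - q ^ S (k + n)))
      with (M * q ^ (k + n) + A * (q ^ n - q ^ (k + n))) by (unfold A; simpl; field; lra).
    lra.
  - apply Rmult_le_compat_l; [exact PA|]; assert (0 <= q ^ (k + n)) by (apply pow_le; lra); lra. }
assert (Hsmall : forall e, 0 < e -> exists N, A * q ^ N < e).
{ intros e He; destruct (pow_lt_1_zero q) with (y := e / (A + 1)) as [N HN].
  - rewrite Rabs_pos_eq; lra.
  - apply Rdiv_lt_0_compat; lra.
  - exists N; specialize (HN N (le_n N)); assert (0 <= q ^ N) by (apply pow_le; lra).
    rewrite Rabs_pos_eq in HN by assumption.
    apply (Rmult_lt_compat_l (A + 1)) in HN; [|lra].
    replace ((A + 1) * (e / (A + 1))) with e in HN by (field; lra); nra. }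
assert (Hlim : forall t, is_lim_seq (fun n => u n t) (l t)).
{ intros t; apply Lim_seq_correct', ex_lim_seq_cauchy_corr; intros [e He].
  destruct (Hsmall (e / 2)) as [N HN]; [lra|]; exists N; intros n m Hn Hm; simpl.
  assert (En := H1 (n - N)%nat N t); assert (Em := H1 (m - N)%nat N t).
  replace (n - N + N)%nat with n in En by lia; replace (m - N + N)%nat with m in Em by lia.
  apply Rabs_le_between in En, Em; apply Rabs_lt_between; lra. }
assert (Hl : forall n t, Rabs (l t - u n t) <= A * q ^ n).
{ intros n t.
  refine (is_lim_seq_le (fun k => Rabs (u (k + n)%nat t - u n t)) (fun _ => A * q ^ n)
    (Rabs (l t - u n t)) (A * q ^ n) _ _ (is_lim_seq_const _)); [intros k; apply H1|].
  apply (is_lim_seq_abs _ (l t - u n t)), is_lim_seq_minus'; [|apply is_lim_seq_const].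
  apply (is_lim_seq_incr_n (fun k => u k t)), Hlim. }
split; [exact Hl|]; intros t.
apply continuity_pt_filterlim; intros e He.
destruct (Hsmall (e / 3)) as [N HN]; [lra|].
assert (C := proj2 (continuity_pt_filterlim (u N) t) (Cu N t)).
destruct (C (e / 3)) as [del [Pdel Hdel]]; [lra|].
exists del; split; [exact Pdel|]; intros s Hs; specialize (Hdel s Hs).
change (Rabs (u N s - u N t) < e / 3) in Hdel; change (Rabs (l s - l t) < e).
assert (E1 := Hl N s); assert (E2 := Hl N t).
apply Rabs_le_between in E1, E2; apply Rabs_lt_between in Hdel; apply Rabs_lt_between; lra.
Qed.

Lemma continuous_Re (u : R -> C) t : continuous u t -> continuous (fun s => Re (u s)) t.
Proof. intros H; apply (continuous_comp u fst); [exact H|apply continuous_fst]. Qed.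

Lemma continuous_Im (u : R -> C) t : continuous u t -> continuous (fun s => Im (u s)) t.
Proof. intros H; apply (continuous_comp u snd); [exact H|apply continuous_snd]. Qed.

Lemma continuous_pair (u v : R -> R) t :
  continuous u t -> continuous v t -> continuous (fun s => (u s, v s) : C) t.
Proof.
intros Hu Hv; apply (continuous_comp_2 u v (fun x y => (x, y))); [assumption|assumption|].
apply (continuous_ext (fun p : R * R => p)); [now intros []|apply continuous_id].
Qed.

Lemma Cmod_le_parts (z : C) a : Rabs (Re z) <= a -> Rabs (Im z) <= a -> Cmod z <= 2 * a.
Proof.
intros H1 H2; apply Rle_trans with (1 := Cmod_2Rmax z).
assert (sqrt 2 <= 2).
{ rewrite <- (sqrt_square 2) at 2 by lra; apply sqrt_le_1_alt; lra. }
assert (0 <= Rabs (Re z)) by apply Rabs_pos.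
assert (Rmax (Rabs (fst z)) (Rabs (snd z)) <= a) by now apply Rmax_lub.
assert (Rabs (fst z) <= Rmax (Rabs (fst z)) (Rabs (snd z))) by apply Rmax_l.
apply Rle_trans with (2 * Rmax (Rabs (fst z)) (Rabs (snd z))); [|lra].
apply Rmult_le_compat_r; [|assumption]; unfold Re in *; lra.
Qed.

Lemma im_le_Cmod (z : C) : Rabs (Im z) <= Cmod z.
Proof. apply Rle_trans with (2 := Rmax_Cmod z), Rmax_r. Qed.

Lemma Cminus_eq_0 (a b : C) : (a - b)%C = 0 -> a = b.
Proof. intros H; replace a with (a - b + b)%C by ring; rewrite H; ring. Qed.

Lemma CT_geometric_limit (X : nat -> CT) (M q : R) : 0 <= q < 1 ->
  (forall n t, Cmod (X (S n) t - X n t) <= M * q ^ n) ->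
  exists x : CT, forall n t, Cmod (x t - X n t) <= 2 * (M / (1 - q)) * q ^ n.
Proof.
intros Hq HX.
destruct (geometric_limit (fun n t => Re (X n t)) M q) as [R1 R2]; [exact Hq| | |].
{ intros n t; apply continuous_Re, CT_continuous. }
{ intros n t; apply Rle_trans with (2 := HX n t), (re_le_Cmod (X (S n) t - X n t)%C). }
destruct (geometric_limit (fun n t => Im (X n t)) M q) as [I1 I2]; [exact Hq| | |].
{ intros n t; apply continuous_Im, CT_continuous. }
{ intros n t; apply Rle_trans with (2 := HX n t), (im_le_Cmod (X (S n) t - X n t)%C). }
set (lr := fun t => real (Lim_seq (fun n => Re (X n t)))) in *.
set (li := fun t => real (Lim_seq (fun n => Im (X n t)))) in *.
unshelve eexists (mkCT (fun t => (lr t, li t) : C) _ _).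
(* The limit is a function of the sequence alone, so periodicity passes to it termwise. *)
- intros t; unfold lr, li; f_equal; f_equal; apply Lim_seq_ext; intros n; now rewrite CT_periodic.
- intros t; now apply continuous_pair.
- intros n t; rewrite Rmult_assoc; apply Cmod_le_parts; [apply R1|apply I1].
Qed.

(** * Reduction of the complex operator to the real one *)

Lemma CT_nonneg_real (u : CT) t : CT_nonneg u -> u t = RtoC (Re (u t)).
Proof.
intros H; destruct (H t) as [Hi _]; destruct (u t) as [a b]; simpl in *; now subst b.
Qed.

Lemma torus_cont_Re (u : CT) : torus_cont (fun t => Re (u t)).
Proof.
split; intros t; [now rewrite CT_periodic|apply continuous_Re, CT_continuous].
Qed.

Lemma torus_cont_Cmod (u : CT) : torus_cont (fun t => Cmod (u t)).
Proof.
split; intros t; [now rewrite CT_periodic|apply continuous_Cmod_comp, CT_continuous].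
Qed.

Definition CT_of_real (u : R -> R) (H : torus_cont u) : CT :=
  mkCT (fun t => RtoC (u t)) (fun t => f_equal RtoC (proj1 H t))
    (fun t => continuous_pair u (fun _ => 0) t (proj2 H t) (continuous_const 0 t)).

Lemma sum_n_RtoC (a : nat -> C) (b : nat -> R) n :
  (forall i, a i = RtoC (b i)) -> sum_n a n = RtoC (sum_f_R0 b n).
Proof.
intros H; induction n as [|n IH]; [rewrite sum_O; apply H|].
rewrite sum_Sn, IH, H; simpl; now rewrite RtoC_plus.
Qed.

Lemma Cmod_sum_n (a : nat -> C) n : Cmod (sum_n a n) <= sum_f_R0 (fun i => Cmod (a i)) n.
Proof.
induction n as [|n IH]; [rewrite sum_O; simpl; lra|].
rewrite sum_Sn; simpl; apply Rle_trans with (1 := Cmod_triangle _ _); lra.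
Qed.

Section Bridge.

Variables (d : nat) (f : CT).
Hypothesis d_ge_2 : (2 <= d)%nat.
Hypothesis f_ge_0 : CT_nonneg f.

Definition phi_of (t : R) : R := Re (f t).

Lemma phi_of_ge_0 t : 0 <= phi_of t.
Proof. apply f_ge_0. Qed.

(** The combination [w] is given by its values, so that the lemma applies alike to [plus], [minus]
    and [scal] on [CT]. *)
Lemma transfer_lin (a b : C) (u v w : CT) :
  (forall t, w t = a * u t + b * v t)%C ->
  forall t, transfer d f w t = (a * transfer d f u t + b * transfer d f v t)%C.
Proof.
intros H t; simpl; unfold transfer_fun.
set (s := fun i => ((t + INR i) / INR d)%R).
assert (E : forall n, sum_n (fun i => (f (s i) * w (s i))%C) n =
  (a * sum_n (fun i => (f (s i) * u (s i))%C) n + b * sum_n (fun i => (f (s i) * v (s i))%C) n)%C :> C).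
{ induction n as [|n IH]; [rewrite !sum_O, H; ring|].
  rewrite !sum_Sn, IH, H; unfold plus; simpl; ring. }
rewrite E; unfold s; ring.
Qed.

Lemma Cmod_transfer_le (u : CT) t :
  Cmod (transfer d f u t) <= rtransfer d phi_of (fun s => Cmod (u s)) t.
Proof.
pose proof (INR_d_ge_2 d d_ge_2); simpl; unfold transfer_fun, rtransfer.
rewrite Cmod_mult, Cmod_R, Rabs_pos_eq by (apply Rlt_le, Rinv_0_lt_compat; lra).
apply Rmult_le_compat_l; [apply Rlt_le, Rinv_0_lt_compat; lra|].
apply Rle_trans with (1 := Cmod_sum_n _ _), sum_Rle; intros i _.
fold (preimage d t i); rewrite Cmod_mult; right; f_equal; unfold phi_of.
rewrite (CT_nonneg_real f) at 1 by exact f_ge_0; rewrite Cmod_R.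
now apply Rabs_pos_eq, phi_of_ge_0.
Qed.

Lemma transfer_real (u : CT) (v : R -> R) : (forall t, u t = RtoC (v t)) ->
  forall t, transfer d f u t = RtoC (rtransfer d phi_of v t).
Proof.
intros H t; simpl; unfold transfer_fun, rtransfer.
rewrite RtoC_mult; f_equal; apply sum_n_RtoC; intros i.
fold (preimage d t i); rewrite H, RtoC_mult; f_equal; now apply CT_nonneg_real.
Qed.

Lemma iter_transfer_real (u : CT) (v : R -> R) n : (forall t, u t = RtoC (v t)) ->
  forall t, Nat.iter n (transfer d f) u t = RtoC (riter d phi_of n v t).
Proof.
intros H; induction n as [|n IH]; [exact H|]; apply (transfer_real _ _ IH).
Qed.

Lemma krein_real : krein (transfer d f) -> real_krein d phi_of.
Proof.
intros Hk u Cu Pu [t0 Ht0].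
destruct (Hk (CT_of_real u Cu)) as [n Hn].
- intros t; split; [reflexivity|apply Pu].
- exists t0; split; [reflexivity|exact Ht0].
- exists n; intros t; destruct (Hn t) as [_ H].
  rewrite (iter_transfer_real _ u) in H by reflexivity; exact H.
Qed.

Lemma holder_real alpha : holder alpha f -> exists K, 0 <= K /\ hol alpha K phi_of.
Proof.
intros [K HK]; exists (Rabs K); split; [apply Rabs_pos|]; intros s t.
unfold modulus; destruct (Req_dec_T (s - t) 0) as [E|E].
- replace s with t by lra; rewrite Rminus_diag, Rabs_R0; lra.
- apply Rle_trans with (1 := re_le_Cmod (f s - f t)%C).
  apply Rle_trans with (1 := HK s t ltac:(lra)).
  apply Rmult_le_compat_r; [apply Rlt_le, exp_pos|apply Rle_abs].
Qed.

Lemma I_int_real n : I_int d f n = RtoC (RInt (birkhoff_prod d phi_of n) 0 1).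
Proof.
unfold I_int; apply (is_RInt_unique (V := C_R_CompleteNormedModule)).
apply (is_RInt_ext (fun t => (birkhoff_prod d phi_of n t, 0) : C)).
- intros t _; symmetry; apply Cprod_RtoC; intros j; now apply CT_nonneg_real.
- apply (is_RInt_fct_extend_pair (fun t => (birkhoff_prod d phi_of n t, 0))).
  + apply (RInt_correct (birkhoff_prod d phi_of n)), torus_cont_RInt.
    apply birkhoff_prod_cont, torus_cont_Re.
  + assert (Z := is_RInt_const (V := R_NormedModule) 0 1 0).
    replace (scal (1 - 0) (0 : R_NormedModule)) with (0 : R_NormedModule) in Z
      by (symmetry; apply Rmult_0_r).
    exact Z.
Qed.

(** * The resolvent and the spectral radius *)

Variables (rho c : R) (g : R -> R).
Hypothesis rho_gt_0 : 0 < rho.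
Hypothesis g_cont : torus_cont g.
Hypothesis c_gt_0 : 0 < c.
Hypothesis g_bounds : forall t, c <= g t <= 1.
Hypothesis g_eigen : forall t, rtransfer d phi_of g t = rho * g t.

(** Applied to |u|, this is the bound [rho] for [L] in the weighted norm [sup |u| / g]. *)
Lemma rtransfer_le_eigen k u : (forall t, u t <= k * g t) ->
  forall t, rtransfer d phi_of u t <= k * rho * g t.
Proof.
intros H t; rewrite Rmult_assoc, <- g_eigen, <- (rtransfer_scal d phi_of d_ge_2 phi_of_ge_0).
now apply (rtransfer_le d phi_of d_ge_2 phi_of_ge_0).
Qed.

(* [g] turns [L] into a contraction of ratio [rho / |z|] after scaling by [1/z]. *)
Lemma resolvent_surjective (z : C) (y : CT) : rho < Cmod z ->
  exists x : CT, (minus (scal z x) (transfer d f x) : CT) = y.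
Proof.
intros Hz.
assert (Nz : z <> RtoC 0) by (apply Cmod_gt_0; lra).
(* Fixed-point iteration for [x = (y + L x) / z] from 0, that is, the partial sums of the Neumann
   series. *)
set (X := nat_rect (fun _ => CT) (CT_const 0)
  (fun _ x => CT_scal (/ z)%C (CT_plus y (transfer d f x)))).
assert (XS : forall n t, X (S n) t = (/ z * (y t + transfer d f (X n) t))%C) by reflexivity.
set (q := rho / Cmod z).
assert (Hq : 0 <= q < 1).
{ unfold q; split; [apply Rle_mult_inv_pos; lra|].
  apply (Rmult_lt_reg_r (Cmod z)); [lra|].
  unfold Rdiv; rewrite Rmult_assoc, Rinv_l; lra. }
(* Since [g >= c], the first iterate [y / z] is at most [M g] in modulus. *)
set (M := CT_norm y / (c * Cmod z)).
assert (PN : 0 <= CT_norm y).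
{ apply Rle_trans with (2 := CT_norm_ge y 0), Cmod_ge_0. }
assert (Pcz : 0 < c * Cmod z) by (apply Rmult_lt_0_compat; lra).
assert (PM : 0 <= M) by now apply Rle_mult_inv_pos.
assert (Hdiff : forall (u v : CT) t, (transfer d f u t - transfer d f v t)%C =
  transfer d f (minus u v) t).
{ intros u v t; rewrite (transfer_lin 1 (- (1))%C u v (minus u v)); [ring|].
  intros s; rewrite CT_minus_fun; ring. }
assert (HX : forall n t, Cmod (X (S n) t - X n t) <= M * q ^ n * g t).
{ induction n as [|n IH]; intros t.
  - rewrite XS; change (X 0%nat) with (CT_const 0).
    assert (Z : transfer d f (CT_const 0) t = 0).
    { rewrite (transfer_lin 0 0 (CT_const 0) (CT_const 0) (CT_const 0)); [ring|]; intros s; simpl; ring. }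
    rewrite Z; simpl.
    replace (/ z * (y t + 0) - 0)%C with (/ z * y t)%C by ring.
    rewrite Cmod_mult, Cmod_inv by exact Nz; unfold M.
    assert (Hy := CT_norm_ge y t); specialize (g_bounds t).
    apply Rle_trans with (/ Cmod z * CT_norm y).
    + apply Rmult_le_compat_l; [apply Rlt_le, Rinv_0_lt_compat; lra|exact Hy].
    + replace (CT_norm y / (c * Cmod z) * 1 * g t)
        with (/ Cmod z * (CT_norm y * (g t / c))) by (field; lra).
      apply Rmult_le_compat_l; [apply Rlt_le, Rinv_0_lt_compat; lra|].
      rewrite <- (Rmult_1_r (CT_norm y)) at 1; apply Rmult_le_compat_l; [exact PN|].
      apply (Rmult_le_reg_r c); [lra|]; unfold Rdiv; rewrite Rmult_assoc, Rinv_l; lra.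
  - rewrite (XS (S n)), (XS n) at 1.
    replace (/ z * (y t + transfer d f (X (S n)) t) - / z * (y t + transfer d f (X n) t))%C
      with (/ z * (transfer d f (X (S n)) t - transfer d f (X n) t))%C by ring.
    rewrite Hdiff, Cmod_mult, Cmod_inv by exact Nz.
    apply Rle_trans with (/ Cmod z * (M * q ^ n * rho * g t)).
    + apply Rmult_le_compat_l; [apply Rlt_le, Rinv_0_lt_compat; lra|].
      apply Rle_trans with (1 := Cmod_transfer_le _ t), rtransfer_le_eigen.
      intros s; rewrite CT_minus_fun; apply IH.
    + right; unfold q; simpl; field; lra. }
destruct (CT_geometric_limit X M q Hq) as [x Hx].
{ intros n t; apply Rle_trans with (1 := HX n t).
  rewrite <- (Rmult_1_r (M * q ^ n)) at 2; apply Rmult_le_compat_l; [|apply g_bounds].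
  apply Rmult_le_pos; [exact PM|apply pow_le; lra]. }
set (B := 2 * (M / (1 - q))) in *.
assert (PB : 0 <= B) by (unfold B; assert (0 <= M / (1 - q)) by (apply Rle_mult_inv_pos; lra); lra).
exists x; apply CT_ext; intros t; rewrite CT_minus_fun.
change (z * x t - transfer d f x t = y t)%C.
(* [z X_(n+1) - L X_n = y], and both terms converge. *)
assert (E : forall n, Cmod (z * x t - transfer d f x t - y t) <= (2 * B * Cmod z / c) * q ^ n).
{ intros n.
  replace (z * x t - transfer d f x t - y t)%C
    with (z * (x t - X (S n) t) - transfer d f (minus x (X n)) t)%C
    by (rewrite <- Hdiff, XS; field; exact Nz).
  assert (T1 : Cmod (z * (x t - X (S n) t)) <= Cmod z * (B * q ^ n)).
  { rewrite Cmod_mult; apply Rmult_le_compat_l; [lra|].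
    apply Rle_trans with (1 := Hx (S n) t), Rmult_le_compat_l; [exact PB|].
    simpl; assert (0 <= q ^ n) by (apply pow_le; lra); nra. }
  assert (Pq : 0 <= B * q ^ n) by (apply Rmult_le_pos; [exact PB|apply pow_le; lra]).
  assert (T2 : Cmod (transfer d f (minus x (X n)) t) <= B * q ^ n / c * rho * g t).
  { apply Rle_trans with (1 := Cmod_transfer_le _ t), rtransfer_le_eigen.
    intros s; rewrite CT_minus_fun; apply Rle_trans with (1 := Hx n s).
    replace (B * q ^ n / c * g s) with (B * q ^ n * (g s / c)) by (field; lra).
    rewrite <- (Rmult_1_r (B * q ^ n)) at 1; apply Rmult_le_compat_l; [exact Pq|].
    specialize (g_bounds s).
    apply (Rmult_le_reg_r c); [lra|]; unfold Rdiv; rewrite Rmult_assoc, Rinv_l; lra. }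
  assert (G1 := g_bounds t).
  assert (Pqc : 0 <= B * q ^ n / c) by now apply Rle_mult_inv_pos.
  assert (T3 : B * q ^ n / c * rho * g t <= B * q ^ n / c * Cmod z).
  { rewrite Rmult_assoc; apply Rmult_le_compat_l; [exact Pqc|nra]. }
  assert (T4 : B * q ^ n <= B * q ^ n / c).
  { apply (Rmult_le_reg_r c); [lra|]; unfold Rdiv; rewrite (Rmult_assoc (B * q ^ n) (/ c)), Rinv_l; nra. }
  apply Rle_trans with (1 := Cmod_triangle _ _); rewrite Cmod_opp.
  replace (2 * B * Cmod z / c * q ^ n)
    with (Cmod z * (B * q ^ n / c) + B * q ^ n / c * Cmod z) by (field; lra).
  assert (Cmod z * (B * q ^ n) <= Cmod z * (B * q ^ n / c))
    by (apply Rmult_le_compat_l; lra).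
  lra. }
assert (E0 : Cmod (z * x t - transfer d f x t - y t) <= 0).
{ refine (is_lim_seq_le (fun _ => _) _ (Finite _) (Finite 0) E (is_lim_seq_const _) _).
  replace (Finite 0) with (Rbar_mult (2 * B * Cmod z / c) 0) by (simpl; f_equal; ring).
  apply is_lim_seq_scal_l, is_lim_seq_geom; rewrite Rabs_pos_eq; lra. }
apply Cminus_eq_0, Cmod_eq_0, Rle_antisym; [exact E0|apply Cmod_ge_0].
Qed.

(** Let [k] be the maximum of |x| / g, attained at [t0]. There [|z| k g <= |y| + rho k g], so
    [k c (|z| - rho) <= CT_norm y], and |x| <= k because [g <= 1]. This yields both the injectivity
    of [z - L] and the boundedness of its inverse. *)
Lemma resolvent_bound (z : C) (x : CT) : rho < Cmod z ->
  CT_norm x <= / (c * (Cmod z - rho)) * CT_norm (minus (scal z x) (transfer d f x)).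
Proof.
intros Hz; set (y := minus (scal z x) (transfer d f x) : CT).
assert (Gp : forall t, 0 < g t) by (intros t; specialize (g_bounds t); lra).
assert (Cm : torus_cont (fun t => Cmod (x t) * / g t)).
{ apply torus_cont_mult; [apply torus_cont_Cmod|]; destruct g_cont as [Pg Cg]; split.
  - intros t; now rewrite Pg.
  - intros t; apply continuous_Rinv_comp; [apply Cg|]; specialize (Gp t); lra. }
destruct (torus_max _ Cm) as [t0 [_ Hmax]].
set (k := Cmod (x t0) * / g t0) in *.
assert (Hk : forall t, Cmod (x t) <= k * g t).
{ intros t; specialize (Hmax t); specialize (Gp t).
  apply (Rmult_le_compat_r (g t)) in Hmax; [|lra].
  rewrite Rmult_assoc, Rinv_l in Hmax; lra. }
assert (Ek : Cmod (x t0) = k * g t0).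
{ unfold k; specialize (Gp t0); field; lra. }
assert (Pk : 0 <= k).
{ apply Rmult_le_pos; [apply Cmod_ge_0|apply Rlt_le, Rinv_0_lt_compat, Gp]. }
assert (T : Cmod (transfer d f x t0) <= k * rho * g t0)
  by (apply Rle_trans with (1 := Cmod_transfer_le x t0), rtransfer_le_eigen, Hk).
assert (Ey : (z * x t0)%C = (y t0 + transfer d f x t0)%C).
{ unfold y; rewrite CT_minus_fun; change ((scal z x : CT) t0) with (z * x t0)%C; ring. }
apply (f_equal Cmod) in Ey; rewrite Cmod_mult, Ek in Ey.
assert (Tr := Cmod_triangle (y t0) (transfer d f x t0)); assert (Ny := CT_norm_ge y t0).
assert (Hkc : k * c * (Cmod z - rho) <= CT_norm y).
{ apply Rle_trans with (k * g t0 * (Cmod z - rho)); [|lra].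
  apply Rmult_le_compat_r; [lra|]; apply Rmult_le_compat_l; [exact Pk|apply g_bounds]. }
apply CT_norm_le; intros t.
apply Rle_trans with k.
- apply Rle_trans with (1 := Hk t); specialize (g_bounds t); nra.
- assert (P : 0 < c * (Cmod z - rho)) by (apply Rmult_lt_0_compat; lra).
  apply (Rmult_le_reg_l (c * (Cmod z - rho))); [exact P|].
  rewrite <- Rmult_assoc, Rinv_r by lra; lra.
Qed.

Lemma CT_minus_transfer (z : C) (x : CT) t :
  (minus (scal z x) (transfer d f x) : CT) t = (z * x t - transfer d f x t)%C.
Proof. rewrite CT_minus_fun; reflexivity. Qed.

Lemma resolvent_injective (z : C) (x x' : CT) : rho < Cmod z ->
  minus (scal z x) (transfer d f x) = minus (scal z x') (transfer d f x') -> x = x'.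
Proof.
intros Hz E; apply CT_ext; intros t.
assert (Hb := resolvent_bound z (minus x x') Hz).
assert (Z : CT_norm (minus (scal z (minus x x')) (transfer d f (minus x x'))) <= 0).
{ apply CT_norm_le; intros s; apply (f_equal (fun w : CT => w s)) in E.
  rewrite !CT_minus_transfer in E.
  rewrite CT_minus_transfer, (transfer_lin 1 (- (1))%C x x' (minus x x')), CT_minus_fun
    by (intros r; rewrite CT_minus_fun; ring).
  replace (z * (x s - x' s) - (1 * transfer d f x s + - (1) * transfer d f x' s))%C
    with ((z * x s - transfer d f x s) - (z * x' s - transfer d f x' s))%C by ring.
  rewrite E; unfold Cminus; rewrite Cplus_opp_r, Cmod_0; lra. }
assert (P : 0 < / (c * (Cmod z - rho)))
  by (apply Rinv_0_lt_compat, Rmult_lt_0_compat; lra).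
apply Cminus_eq_0, Cmod_eq_0, Rle_antisym; [|apply Cmod_ge_0].
assert (Hn := CT_norm_ge (minus x x') t); rewrite CT_minus_fun in Hn; nra.
Qed.

(** The inverse is chosen pointwise from surjectivity; its linearity is checked after applying the
    injective map [z - L]. *)
Lemma large_in_resolvent_set (z : C) : rho < Cmod z -> in_resolvent_set (transfer d f) z.
Proof.
intros Hz.
set (S := fun y => proj1_sig (constructive_indefinite_description _
  (resolvent_surjective z y Hz))).
assert (HS : forall y, (minus (scal z (S y)) (transfer d f (S y)) : CT) = y)
  by (intros y; unfold S; apply proj2_sig).
exists S; split; [split|split].
- intros x y; apply (resolvent_injective z); [exact Hz|]; rewrite HS.
  apply CT_ext; intros t.
  rewrite CT_minus_transfer, (transfer_lin 1 1 (S x) (S y) (plus (S x) (S y))) by (intros s; simpl; ring).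
  assert (Ex := CT_minus_transfer z (S x) t); assert (Ey := CT_minus_transfer z (S y) t).
  rewrite HS in Ex, Ey.
  change ((plus x y : CT) t) with (x t + y t)%C; rewrite Ex, Ey; simpl; ring.
- intros k x; apply (resolvent_injective z); [exact Hz|]; rewrite HS.
  apply CT_ext; intros t.
  rewrite CT_minus_transfer, (transfer_lin k 0 (S x) (S x) (scal k (S x))) by (intros s; simpl; ring).
  assert (Ex := CT_minus_transfer z (S x) t); rewrite HS in Ex.
  change ((scal k x : CT) t) with (k * x t)%C; rewrite Ex; simpl; ring.
- exists (/ (c * (Cmod z - rho))); split.
  + apply Rinv_0_lt_compat, Rmult_lt_0_compat; lra.
  + intros x; assert (Hb := resolvent_bound z (S x) Hz); rewrite HS in Hb; exact Hb.
- intros x; apply (resolvent_injective z); [exact Hz|apply HS].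
- exact HS.
Qed.

(** [rho - L] maps the eigenfunction to 0, so a linear inverse would send 0 to it and force it to be
    0. *)
Lemma rate_in_spectrum : in_spectrum (transfer d f) (RtoC rho).
Proof.
intros [S [HS [H1 _]]].
set (G := CT_of_real g g_cont).
assert (Z : (minus (scal (RtoC rho) G) (transfer d f G) : CT) = CT_const 0).
{ apply CT_ext; intros t; rewrite CT_minus_transfer, (transfer_real G g) by reflexivity.
  rewrite g_eigen; simpl; rewrite RtoC_mult; ring. }
assert (SG := eq_trans (f_equal S (eq_sym Z)) (H1 G)).
assert (E := linear_scal S HS (RtoC 0) (CT_const 0)).
assert (E0 : scal (RtoC 0) (CT_const 0) = CT_const 0) by (apply CT_ext; intros t; simpl; ring).
assert (EG : G = scal (RtoC 0) G).
{ exact (eq_trans (eq_sym SG)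
    (eq_trans (f_equal S (eq_sym E0)) (eq_trans E (f_equal (scal (RtoC 0)) SG)))). }
apply (f_equal (fun u : CT => Re (u 0))) in EG; simpl in EG.
specialize (g_bounds 0); lra.
Qed.

Lemma spectral_radius_rate : spectral_radius (transfer d f) = Finite rho.
Proof.
apply is_lub_Rbar_unique; split.
- intros x [z [Hz ->]]; simpl; apply Rnot_lt_le; intros Hlt.
  now apply Hz, large_in_resolvent_set.
- intros b Hb; apply Hb; exists (RtoC rho); split; [exact rate_in_spectrum|].
  rewrite Cmod_R, Rabs_pos_eq; lra.
Qed.

(** * The rates [r], [R] and [c(f)] *)

Lemma iter_one_real n t : iter_one d f n t = riter d phi_of n (fun _ => 1) t.
Proof. unfold iter_one; now rewrite (iter_transfer_real _ (fun _ => 1)). Qed.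

(** Compare 1 with the eigenfunction: [g <= 1] gives the lower bound and [c <= g] the upper one,
    since [L^n g = rho^n g]. *)
Lemma iter_one_bounds n t : c * rho ^ n <= iter_one d f n t <= / c * rho ^ n.
Proof.
rewrite iter_one_real; assert (Pr : 0 < rho ^ n) by now apply pow_lt.
assert (E := riter_eigen d phi_of d_ge_2 phi_of_ge_0 rho g n t g_eigen).
assert (U := riter_le_sup d phi_of d_ge_2 phi_of_ge_0 n 1 g t (fun s => proj2 (g_bounds s))).
assert (L := riter_ge_inf d phi_of d_ge_2 phi_of_ge_0 n c g t (fun s => proj1 (g_bounds s))).
rewrite E in U, L; specialize (g_bounds t); split; [nra|].
apply (Rmult_le_reg_l c); [exact c_gt_0|]; rewrite <- Rmult_assoc, Rinv_r by lra; nra.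
Qed.

Lemma torus_cont_iter_one n : torus_cont (iter_one d f n).
Proof. apply torus_cont_Re. Qed.

Lemma lower_root_lim : is_lim_seq (lower_root d f) rho.
Proof.
apply (nth_root_lim _ rho c (/ c)); auto using Rinv_0_lt_compat.
intros n; destruct (torus_min _ (torus_cont_iter_one n)) as [t [-> _]]; apply iter_one_bounds.
Qed.

Lemma upper_root_lim : is_lim_seq (upper_root d f) rho.
Proof.
apply (nth_root_lim _ rho c (/ c)); auto using Rinv_0_lt_compat.
intros n; destruct (torus_max _ (torus_cont_iter_one n)) as [t [-> _]]; apply iter_one_bounds.
Qed.

Lemma I_root_lim : is_lim_seq (I_root d f) rho.
Proof.
apply (nth_root_lim _ rho c (/ c)); auto using Rinv_0_lt_compat; intros n.
assert (B := RInt_birkhoff_bounds d phi_of d_ge_2 (torus_cont_Re f) phi_of_ge_0 rho c g n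
  g_cont g_eigen rho_gt_0 c_gt_0 g_bounds).
rewrite I_int_real, Cmod_R, Rabs_pos_eq; [exact B|].
pose proof (pow_lt rho n rho_gt_0); nra.
Qed.

End Bridge.

(* [Lim_seq] is a total operator, so the existence of the limits defining r and
   R is part of the conclusion. *)
Theorem theorem2p7 (d : nat) (alpha : R) (f : CT) :
  (2 <= d)%nat ->
  0 < alpha <= 1 ->
  CT_nonneg f ->
  holder alpha f ->
  krein (transfer d f) ->
  ex_lim_seq (lower_root d f) /\
  ex_lim_seq (upper_root d f) /\
  lower_rate d f = c_rate d f /\
  c_rate d f = upper_rate d f /\
  upper_rate d f = spectral_radius (transfer d f) /\
  is_lim_seq (I_root d f) (c_rate d f).
Proof.
intros Hd [Ha _] Pf Hf Hk.
destruct (holder_real f alpha Hf) as [K [PK HK]].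
destruct (perron_pair d (phi_of f) alpha K Hd (torus_cont_Re f) (phi_of_ge_0 f Pf) Ha PK HK
  (krein_real d f Pf Hk)) as [rho [g [c [Pr [Cg [Pc [Bg Eg]]]]]]].
assert (Hl := lower_root_lim d f Hd Pf rho c g Pr Pc Bg Eg).
assert (Hu := upper_root_lim d f Hd Pf rho c g Pr Pc Bg Eg).
assert (Hi := I_root_lim d f Hd Pf rho c g Pr Cg Pc Bg Eg).
assert (El : lower_rate d f = rho) by now apply is_lim_seq_unique.
assert (Eu : upper_rate d f = rho) by now apply is_lim_seq_unique.
assert (Ec : c_rate d f = rho) by now apply is_LimSup_seq_unique, is_lim_LimSup_seq.
rewrite El, Eu, Ec, (spectral_radius_rate d f Hd Pf rho c g Pr Cg Pc Bg Eg).
repeat split; [now exists rho|now exists rho|exact Hi].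
Qed.
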